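(* Let $\tilde w_1,\dots,\tilde w_r\in\tilde W$ lie in pairwise distinct conjugacy classes of $\tilde W$. Then the images of $T_{\tilde w_1},\dots,T_{\tilde w_r}$ in $\tilde H_{\mathbb C}/[\tilde H_{\mathbb C},\tilde H_{\mathbb C}]$ are linearly independent over $\mathbb C[v,v^{-1}]$.
   Context: Setting: $W=Q\rtimes W_0$ affine Weyl group with simple reflections $S$; $\tilde W=P\rtimes(W_0\rtimes\Omega')=W\rtimes\Omega$ for a connected complex reductive group with coweight lattice $P$ and finite group $\Omega'$ of diagram automorphisms; $\ell$ the length on $\tilde W$. $\mathcal A=\mathbb Z[v,v^{-1}]$; $\tilde H$ is the $\mathcal A$-algebra with basis $\{T_w\}_{w\in\tilde W}$, $T_xT_y=T_{xy}$ when $\ell(xy)=\ell(x)+\ell(y)$, and $(T_s-v)(T_s+v^{-1})=0$ for $s\in S$. $\tilde H_{\mathbb C}=\tilde H\otimes_{\mathcal A}\mathbb C[v,v^{-1}]$ and $[\tilde H_{\mathbb C},\tilde H_{\mathbb C}]$ is the $\mathbb C[v,v^{-1}]$-span of commutators. *)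

(* Defs.v *)
(* Extended affine Weyl group of a (reduced, based) root datum,
   its length function (count of separating affine root hyperplanes),
   and the Iwahori-Hecke algebra over C[v,v^-1], presented as a C-algebra
   containing a central unit V (= v) in which the T_w form a C[V,V^-1]-basis. *)
From HB Require Import structures.
From mathcomp Require Import all_boot all_order all_algebra.
Set Implicit Arguments. Unset Strict Implicit. Unset Printing Implicit Defensive.
Import Order.TTheory GRing.Theory Num.Theory.
Local Open Scope ring_scope.

(* Root datum data: X = 'rV[int]_n (characters), Y = P = 'cV[int]_n (cocharacters),
   pairing <y, x> = x *m y.  Roots a i, coroots ac i, i : 'I_nroots, and a set of
   simple roots. *)
Record rdatum (n : nat) := RDatum {
  nroots : nat;
  root : 'I_nroots -> 'rV[int]_n;
  coroot : 'I_nroots -> 'cV[int]_n;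
  simple : pred 'I_nroots }.

Section RD.
Variable n : nat.
Variable D : rdatum n.
Local Notation m := (nroots D).
Local Notation a := (@root n D).
Local Notation ac := (@coroot n D).

Definition rpair (y : 'cV[int]_n) (x : 'rV[int]_n) : int := (x *m y) ord0 ord0.

Definition is_root_datum : Prop :=
  injective a /\ injective ac /\
  (forall i, rpair (ac i) (a i) = 2) /\
  (forall i j, exists k,
      a k = a j - (rpair (ac i) (a j)) *: a i /\
      ac k = ac j - (rpair (ac j) (a i)) *: ac i) /\
  (forall i j, a j <> 2%:Z *: a i).

Definition posc (i : 'I_m) : Prop :=
  exists c : 'I_m -> nat, a i = \sum_(j | @simple n D j) (c j)%:Z *: a j.
Definition negc (i : 'I_m) : Prop :=
  exists c : 'I_m -> nat, a i = - \sum_(j | @simple n D j) (c j)%:Z *: a j.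

Definition toQr (x : 'rV[int]_n) : 'rV[rat]_n := map_mx (fun z : int => z%:~R) x.
Definition toQc (y : 'cV[int]_n) : 'cV[rat]_n := map_mx (fun z : int => z%:~R) y.
Definition toQm (g : 'M[int]_n) : 'M[rat]_n := map_mx (fun z : int => z%:~R) g.

Definition is_base : Prop :=
  (forall c : 'I_m -> rat,
     \sum_(j | @simple n D j) c j *: toQr (a j) = 0 -> forall j, @simple n D j -> c j = 0) /\
  (forall i, posc i \/ negc i).

Definition diag_aut (s : 'M[int]_n) : Prop :=
  exists t : 'M[int]_n,
    s *m t = 1%:M /\ t *m s = 1%:M /\
    forall i, exists j, a j = a i *m t /\ ac j = s *m ac i /\ @simple n D j = @simple n D i.

Definition is_diag_group (Om : seq 'M[int]_n) : Prop :=
  1%:M \in Om /\ (forall s t, s \in Om -> t \in Om -> s *m t \in Om) /\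
  (forall s, s \in Om -> diag_aut s).

Definition refl (i : 'I_m) : 'M[int]_n := 1%:M - ac i *m a i.
Definition inW0 (g : 'M[int]_n) : Prop :=
  exists l : seq 'I_m, g = foldr (fun i M => refl i *m M) 1%:M l.

(* elements (lambda, g) of P x GL(Y), standing for t^lambda g *)
Definition elt := ('cV[int]_n * 'M[int]_n)%type.
Definition emul (x y : elt) : elt := (x.1 + x.2 *m y.1, x.2 *m y.2).
Definition eone : elt := (0, 1%:M).

Definition inWt (Om : seq 'M[int]_n) (x : elt) : Prop :=
  exists w s, inW0 w /\ s \in Om /\ x.2 = w *m s.
Definition inQ (l : 'cV[int]_n) : Prop := exists c : 'I_m -> int, l = \sum_i c i *: ac i.
Definition inW (x : elt) : Prop := inQ x.1 /\ inW0 x.2.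

Definition conjugate (Om : seq 'M[int]_n) (x y : elt) : Prop :=
  exists z, inWt Om z /\ emul z x = emul y z.

(* fundamental alcove in Y (x) Q, affine action, length = number of affine root
   hyperplanes H_{alpha,k} (alpha > 0, k in Z) separating A and xA *)
Definition qpair (p : 'cV[rat]_n) (x : 'rV[int]_n) : rat := (toQr x *m p) ord0 ord0.
Definition in_alcove (p : 'cV[rat]_n) : Prop :=
  forall i, posc i -> 0 < qpair p (a i) < 1.
Definition eact (x : elt) (p : 'cV[rat]_n) : 'cV[rat]_n := toQc x.1 + toQm x.2 *m p.
Definition separates (x : elt) (i : 'I_m) (k : int) : Prop :=
  forall p, in_alcove p ->
    (qpair p (a i) - k%:~R) * (qpair (eact x p) (a i) - k%:~R) < 0.
Definition has_length (x : elt) (N : nat) : Prop :=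
  exists s : seq ('I_m * int), uniq s /\ size s = N /\
    forall i k, (i, k) \in s <-> (posc i /\ separates x i k).

Section Hecke.
Variables (Om : seq 'M[int]_n) (C : fieldType) (H : algType C).
Variables (T : elt -> H) (V Vi : H).

Definition lpow (k : int) : H :=
  match k with Posz j => V ^+ j | Negz j => Vi ^+ j.+1 end.

(* H is the Hecke algebra tilde H_C: V is a central unit (the parameter v),
   {V^k T_w} is a C-basis (i.e. {T_w} is a C[v,v^-1]-basis, v transcendental),
   and the defining relations hold. *)
Definition is_hecke : Prop :=
  V * Vi = 1 /\ Vi * V = 1 /\ (forall h, V * h = h * V) /\
  (forall s : seq (int * elt), uniq s -> (forall e, e \in s -> inWt Om e.2) ->
     forall c : int * elt -> C,
       \sum_(e <- s) c e *: (lpow e.1 * T e.2) = 0 -> forall e, e \in s -> c e = 0) /\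
  (forall h : H, exists s : seq (int * elt), exists c : int * elt -> C,
     (forall e, e \in s -> inWt Om e.2) /\ h = \sum_(e <- s) c e *: (lpow e.1 * T e.2)) /\
  T eone = 1 /\
  (forall x y Nx Ny, inWt Om x -> inWt Om y -> has_length x Nx -> has_length y Ny ->
     has_length (emul x y) (Nx + Ny) -> T (emul x y) = T x * T y) /\
  (forall s, inW s -> has_length s 1 -> (T s - V) * (T s + Vi) = 0).

Definition in_laurent (h : H) : Prop :=
  exists s : seq int, exists d : int -> C, h = \sum_(k <- s) d k *: lpow k.

(* [H,H]: span of commutators (C[v,v^-1]-span = C-span since V is central) *)
Definition in_commutator (h : H) : Prop :=
  exists s : seq (H * H), h = \sum_(p <- s) (p.1 * p.2 - p.2 * p.1).
End Hecke.
End RD.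

(* Main.v *)
(* At v = 1 the algebra becomes the group algebra of W~, whose commutators are
   killed by all class functions; so in a relation between the T_(w_i) every
   coefficient vanishes at v = 1.  To divide by v - 1 and repeat, one needs that
   H/[H,H] has no (v - 1)-torsion.

   Modulo (v - 1)[H,H] the commutator [A, B] depends only on A, B modulo v - 1,
   and e(g, y) = [T_(g y^-1), T_y] is a cocycle on the conjugation groupoid:
   e(g, yz) = e(g, z) + e(z g z^-1, y).  On the centralizer of g it is additive, and
   it vanishes there: some power b of z acts trivially on the roots; for large N,
   l(g b^N b) = l(g b^N) + l(b), hence T_(g b^N) T_b^-(N+1) is a lift of g b^-1 that
   commutes with T_b.  So e is a coboundary, [T_x, T_y] = p(yx) - p(xy) modulo
   (v - 1)[H,H], and extending p to the linear map h |-> p(h at v = 1), which is zero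
   on (v - 1)H, shows that (v - 1)h in [H,H] forces (v - 1)h in (v - 1)[H,H].

   That the T_w multiply as in the group modulo v - 1 rests on the exchange property:
   if x moves the alcove A, then among the affine roots separating A from xA first met
   along a segment from A to xA, one that is closest to the starting point gives a
   reflection of length 1. *)
From mathcomp Require Import fingroup perm boolp.
Require Import Defs.
From HB Require Import structures.
From mathcomp Require Import all_boot all_order all_algebra.
From mathcomp Require Import zify ring lra.
Set Implicit Arguments. Unset Strict Implicit. Unset Printing Implicit Defensive.
Import Order.TTheory GRing.Theory Num.Theory.
Local Open Scope ring_scope.

(** * Roots *)

Section Pairing.
Variable n : nat.
Implicit Types (x : 'rV[int]_n) (y : 'cV[int]_n) (g : 'M[int]_n) (p : 'cV[rat]_n).

Lemma rpairDl y y' x : rpair (y + y') x = rpair y x + rpair y' x.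
Proof. by rewrite /rpair mulmxDr mxE. Qed.
Lemma rpairDr y x x' : rpair y (x + x') = rpair y x + rpair y x'.
Proof. by rewrite /rpair mulmxDl mxE. Qed.
Lemma rpairNl y x : rpair (- y) x = - rpair y x.
Proof. by rewrite /rpair mulmxN mxE. Qed.
Lemma rpairNr y x : rpair y (- x) = - rpair y x.
Proof. by rewrite /rpair mulNmx mxE. Qed.
Lemma rpairZl k y x : rpair (k *: y) x = k * rpair y x.
Proof. by rewrite /rpair -scalemxAr mxE. Qed.
Lemma rpairZr k y x : rpair y (k *: x) = k * rpair y x.
Proof. by rewrite /rpair -scalemxAl mxE. Qed.
Lemma rpair0l x : rpair 0 x = 0.
Proof. by rewrite /rpair mulmx0 mxE. Qed.
Lemma rpair_suml I (r : seq I) (F : I -> 'cV[int]_n) x :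
  rpair (\sum_(i <- r) F i) x = \sum_(i <- r) rpair (F i) x.
Proof. by rewrite /rpair mulmx_sumr summxE. Qed.
Lemma rpair_sumr I (r : seq I) y (F : I -> 'rV[int]_n) :
  rpair y (\sum_(i <- r) F i) = \sum_(i <- r) rpair y (F i).
Proof. by rewrite /rpair mulmx_suml summxE. Qed.
Lemma rpairM g y x : rpair (g *m y) x = rpair y (x *m g).
Proof. by rewrite /rpair mulmxA. Qed.

Lemma mul_row_col x y x' : (x *m y) *m x' = rpair y x *: x'.
Proof. by rewrite [x *m y]mx11_scalar mul_scalar_mx. Qed.
Lemma mul_col_row y y' x : y *m (x *m y') = rpair y' x *: y.
Proof. by rewrite [x *m y']mx11_scalar mul_mx_scalar. Qed.

Lemma qpairDl p p' x : qpair (p + p') x = qpair p x + qpair p' x.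
Proof. by rewrite /qpair mulmxDr mxE. Qed.
Lemma qpairZl k p x : qpair (k *: p) x = k * qpair p x.
Proof. by rewrite /qpair -scalemxAr mxE. Qed.
Lemma qpairN p x : qpair p (- x) = - qpair p x.
Proof. by rewrite /qpair /toQr map_mxN mulNmx mxE. Qed.
Lemma qpairD p x x' : qpair p (x + x') = qpair p x + qpair p x'.
Proof. by rewrite /qpair /toQr map_mxD mulmxDl mxE. Qed.
Lemma qpairZ p k x : qpair p (k *: x) = k%:~R * qpair p x.
Proof. by rewrite /qpair /toQr map_mxZ -scalemxAl mxE. Qed.
Lemma qpair_sum p I (r : seq I) (P : pred I) (F : I -> 'rV[int]_n) :
  qpair p (\sum_(i <- r | P i) F i) = \sum_(i <- r | P i) qpair p (F i).
Proof. by rewrite /qpair /toQr (map_mx_sum intr) mulmx_suml summxE. Qed.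
Lemma qpair_eact (e : elt n) p x :
  qpair (eact e p) x = (rpair e.1 x)%:~R + qpair p (x *m e.2).
Proof.
rewrite /eact qpairDl; congr (_ + _).
  by rewrite /qpair /rpair /toQr /toQc -map_mxM mxE.
by rewrite /qpair /toQr /toQm map_mxM mulmxA.
Qed.

End Pairing.

(** * Reflections and automorphisms of the root system *)

Section RootDatum.
Variables (n : nat) (D : rdatum n).
Local Notation m := (nroots D).
Local Notation a := (@Defs.root n D).
Local Notation ac := (@Defs.coroot n D).
Hypothesis HD : is_root_datum D.

Lemma root_inj : injective a. Proof. by case: HD. Qed.
Lemma rpair_root i : rpair (ac i) (a i) = 2.
Proof. by case: HD => _ [_ []]. Qed.
Lemma root_nz i : a i <> 0.
Proof. by move=> h; have := rpair_root i; rewrite h /rpair mul0mx mxE. Qed.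
Lemma root_reduced i j : a j <> 2%:Z *: a i.
Proof. by case: HD => _ [_ [_ []]]. Qed.

Lemma root_refl (i : 'I_m) (x : 'rV_n) : x *m refl i = x - rpair (ac i) x *: a i.
Proof. by rewrite /refl mulmxBr mulmx1 mulmxA mul_row_col. Qed.
Lemma coroot_refl (i : 'I_m) (y : 'cV_n) : refl i *m y = y - rpair y (a i) *: ac i.
Proof. by rewrite /refl mulmxBl mul1mx -mulmxA mul_col_row. Qed.

(** The reflection in [a i] as a permutation of root indices; the root datum axioms make the default
    [j] unreachable. *)
Definition sroot (i j : 'I_m) : 'I_m :=
  odflt j [pick k | (a k == a j *m refl i) && (ac k == refl i *m ac j)].

Lemma sroot_spec i j : a (sroot i j) = a j *m refl i /\ ac (sroot i j) = refl i *m ac j.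
Proof.
rewrite /sroot; case: pickP => [k /andP[/eqP-> /eqP->] //|h].
have [k [h1 h2]] : exists k, a k = a j - rpair (ac i) (a j) *: a i /\
  ac k = ac j - rpair (ac j) (a i) *: ac i by case: HD => _ [_ [_ []]].
by have := h k; rewrite root_refl coroot_refl h1 h2 !eqxx.
Qed.

Lemma refl_refl (i : 'I_m) : refl i *m refl i = 1%:M.
Proof.
rewrite {1}/refl mulmxBl mul1mx -mulmxA root_refl rpair_root.
rewrite (_ : a i - 2 *: a i = - a i); last by rewrite scaler_nat mulr2n opprD addrA subrr add0r.
by rewrite mulmxN opprK /refl subrK.
Qed.

Lemma srootK i : involutive (sroot i).
Proof.
move=> j; apply: root_inj; case: (sroot_spec i (sroot i j)) => -> _.
by case: (sroot_spec i j) => -> _; rewrite -mulmxA refl_refl mulmx1.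
Qed.

(** The reflection in [a i] sends that root to its opposite. *)
Definition negr (i : 'I_m) := sroot i i.
Lemma root_neg i : a (negr i) = - a i.
Proof.
case: (sroot_spec i i) => -> _; rewrite root_refl rpair_root.
by rewrite scaler_nat mulr2n opprD addrA subrr add0r.
Qed.
Lemma negrK : involutive negr.
Proof. by move=> i; apply: root_inj; rewrite !root_neg opprK. Qed.

(* Matrices act on roots on the right: [a i *m y] is the root [a i] composed with [y]. *)
Definition raut (y : 'M[int]_n) : Prop :=
  y \in unitmx /\ forall i, exists j, a j = a i *m y.
Definition ract (y : 'M[int]_n) (i : 'I_m) : 'I_m := odflt i [pick k | a k == a i *m y].

Lemma ractE y i : raut y -> a (ract y i) = a i *m y.
Proof.
move=> [_ /(_ i)[j hj]]; rewrite /ract; case: pickP => [k /eqP //|/(_ j)].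
by rewrite hj eqxx.
Qed.
Lemma rautM y z : raut y -> raut z -> raut (y *m z).
Proof.
move=> hy hz; split; first by rewrite unitmx_mul hy.1 hz.1.
by move=> i; exists (ract z (ract y i)); rewrite !ractE // mulmxA.
Qed.
Lemma raut1 : raut 1%:M.
Proof. by split=> [|i]; [rewrite unitmx1|exists i; rewrite mulmx1]. Qed.
Lemma raut_refl (i : 'I_m) : raut (refl i).
Proof.
split; last by move=> j; exists (sroot i j); case: (sroot_spec i j).
by case/mulmx1_unit: (refl_refl i).
Qed.
Lemma ractM y z i : raut y -> raut z -> ract (y *m z) i = ract z (ract y i).
Proof. by move=> hy hz; apply: root_inj; rewrite !ractE // ?mulmxA //; apply: rautM. Qed.
Lemma ract1 i : ract 1%:M i = i.
Proof. by apply: root_inj; rewrite ractE ?mulmx1 //; apply: raut1. Qed.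
Lemma ract_inj y : raut y -> injective (ract y).
Proof.
move=> hy i j h; apply: root_inj; apply: (can_inj (mulmxK hy.1)).
by rewrite -!ractE // h.
Qed.
Lemma ract_neg y i : raut y -> ract y (negr i) = negr (ract y i).
Proof. by move=> hy; apply: root_inj; rewrite root_neg !ractE // root_neg mulNmx. Qed.
Lemma ract_refl (i j : 'I_m) : ract (refl i) j = sroot i j.
Proof.
apply: root_inj; rewrite ractE; first by case: (sroot_spec i j).
exact: raut_refl.
Qed.
Lemma rautV y : raut y -> raut (invmx y).
Proof.
move=> hy; split; first by rewrite unitmx_inv hy.1.
move=> i; exists (invF (ract_inj hy) i).
by rewrite -{2}(f_invF (ract_inj hy) i) ractE // mulmxK // hy.1.
Qed.

End RootDatum.

(** * A point of the fundamental alcove *)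

Section Base.
Variables (n : nat) (D : rdatum n).
Local Notation m := (nroots D).
Local Notation a := (@Defs.root n D).
Local Notation ac := (@Defs.coroot n D).
Hypothesis (HD : is_root_datum D) (HB : is_base D).

(** Linearly independent simple roots all take the value 1 at some point. Positive roots are then at
    least 1 there, and rescaling brings them below 1. *)
Lemma exists_alcove_point : exists p, in_alcove D p.
Proof.
have [p hp] : exists p : 'cV[rat]_n, forall j, @Defs.simple n D j -> qpair p (a j) = 1.
  pose sd := {j : 'I_m | @Defs.simple n D j}.
  pose A : 'M[rat]_(#|{: sd}|, n) := \matrix_i toQr (a (val (enum_val i))).
  have fA : row_free A.
    apply/row_freeP; exists (pinvmx A); apply/eqP; rewrite -subr_eq0; apply/eqP.
    set B := _ - _; suff hB : B *m A = 0.
      apply/row_matrixP => i; rewrite row0.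
      have hc : row i B *m A = 0 by rewrite -row_mul hB row0.
      (* A row of [B], extended by zero to all root indices, is a linear relation between the simple
         roots. *)
      pose c (j : 'I_m) := if insub j : option sd is Some u then row i B 0 (enum_rank u) else 0.
      have hs : \sum_(j | @Defs.simple n D j) c j *: toQr (a j) = 0.
        transitivity (row i B *m A); last exact: hc.
        rewrite mulmx_sum_row.
        rewrite (reindex_omap (fun k : 'I_#|{: sd}| => val (enum_val k))
          (fun j => omap enum_rank (insub j : option sd))) /=; last first.
          by move=> j hj; rewrite insubT /= enum_rankK.
        apply: eq_big => [k|k _].
          by rewrite (valP (enum_val k)) valK /= enum_valK eqxx.
        by rewrite /c valK enum_valK rowK.
      have := HB.1 c hs => h; apply/rowP => k; rewrite [RHS]mxE.
      by have := h _ (valP (enum_val k)); rewrite /c valK enum_valK.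
    by rewrite mulmxBl mul1mx mulmxKpV // subrr.
  have [B hB] := row_freeP fA.
  exists (\col_k \sum_i B k i) => j hj.
  pose u : sd := exist _ j hj; pose k := enum_rank u.
  rewrite /qpair; have -> : toQr (a j) = row k A by rewrite rowK enum_rankK.
  have -> : (\col_k \sum_i B k i) = B *m const_mx 1.
    apply/matrixP => x y; rewrite !mxE; apply: eq_bigr => z _.
    by rewrite mxE mulr1.
  by rewrite mulmxA -row_mul hB -row_mul mul1mx !mxE.
have hpos i : posc i -> 1 <= qpair p (a i).
  move=> [c hc].
  have e : qpair p (a i) = (\sum_(j | @Defs.simple n D j) c j)%N%:R.
    rewrite hc qpair_sum natr_sum; apply: eq_bigr => j hj.
    by rewrite qpairZ hp // mulr1.
  rewrite e ler1n lt0n; apply/eqP => h0; apply: (root_nz HD (i := i)).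
  rewrite hc big1 // => j hj.
  have := h0; move/eqP; rewrite sum_nat_eq0 => /forallP /(_ j); rewrite hj => /eqP ->.
  by rewrite scale0r.
pose N : rat := 1 + \sum_i `|qpair p (a i)|.
have hN i : `|qpair p (a i)| < N.
  rewrite /N (bigD1 i) //= addrCA ltrDl; apply: ltr_pwDl => //.
  by apply: sumr_ge0.
have N0 : 0 < N by rewrite /N; apply: ltr_pwDl => //; apply: sumr_ge0.
exists (N^-1 *: p) => i hi; rewrite qpairZl mulrC.
have h1 := hpos i hi; rewrite divr_gt0 ?(lt_le_trans ltr01 h1) //=.
by rewrite ltr_pdivrMr // mul1r (le_lt_trans (ler_norm _)).
Qed.

End Base.

(** * Length *)

(* The [k] for which the hyperplane [a = k] separates the strip [0 < a < 1] from the
   strip [d < a < d + 1]. *)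
Definition kseq (d : int) : seq int :=
  match d with
  | Posz j => [seq Posz t | t <- iota 1 j]
  | Negz j => [seq - Posz t | t <- iota 0 j.+1]
  end.

Lemma mem_kseq d k : (k \in kseq d) = (0 < k <= d) || (d < k <= 0).
Proof.
case: d => j /=; first (apply/mapP/idP).
- by case=> t; rewrite mem_iota => h ->; lia.
- by move=> h; exists `|k|%N; rewrite ?mem_iota; lia.
apply/(@mapP _ _ (fun t => - Posz t) (iota 0 j.+1))/idP.
- by case=> t; rewrite mem_iota => h ->; lia.
by move=> h; exists `|k|%N; rewrite ?mem_iota; lia.
Qed.

Lemma uniq_kseq d : uniq (kseq d).
Proof.
case: d => j; rewrite /kseq map_inj_uniq ?iota_uniq //; first by move=> x y [].
by move=> x y /oppr_inj [].
Qed.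

Lemma size_kseq d : size (kseq d) = `|d|%N.
Proof. by case: d => j; rewrite /kseq size_map size_iota //; lia. Qed.

Lemma gt_floor (q : rat) (d k : int) : d%:~R < q < (d + 1)%:~R -> (k%:~R < q) = (k <= d).
Proof.
move=> /andP[h1 h2]; apply/idP/idP => h.
  by have := lt_trans h h2; rewrite ltr_int ltzD1.
by apply: le_lt_trans h1; rewrite ler_int.
Qed.

Lemma lt_floor (q : rat) (d k : int) : d%:~R < q < (d + 1)%:~R -> (q < k%:~R) = (d < k).
Proof.
move=> /andP[h1 h2]; apply/idP/idP => h.
  by have := lt_trans h1 h; rewrite ltr_int.
by apply: (lt_le_trans h2); rewrite ler_int -ltzD1 ltrD2r.
Qed.

Section Length.
Variables (n : nat) (D : rdatum n) (p0 : 'cV[rat]_n).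
Local Notation m := (nroots D).
Local Notation a := (@Defs.root n D).
Local Notation ac := (@Defs.coroot n D).
Hypothesis (HD : is_root_datum D) (HB : is_base D) (Hp0 : in_alcove D p0).

Definition pos (i : 'I_m) : bool := 0 < qpair p0 (a i).
Definition fl (i : 'I_m) : int := if pos i then 0 else -1.

Lemma negc_posc (i : 'I_m) : negc i -> posc (negr i).
Proof.
by move=> [c hc]; exists c; rewrite (root_neg HD) hc opprK.
Qed.

Lemma posP i : reflect (posc i) (pos i).
Proof.
apply: (iffP idP) => [h|/Hp0 /andP[] //].
case: (HB.2 i) => // /negc_posc /Hp0; rewrite root_neg // qpairN.
by move: h; rewrite /pos; lra.
Qed.

Lemma pos_neg i : pos (negr i) = ~~ pos i.
Proof.
have [/posP h|h] := boolP (pos i).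
  apply/negbTE; move: (Hp0 h); rewrite /pos root_neg // qpairN; lra.
apply/posP/negc_posc; case: (HB.2 i) => // /posP h1.
by rewrite h1 in h.
Qed.

Lemma fl_neg i : fl (negr i) = -1 - fl i.
Proof. by rewrite /fl pos_neg; case: pos. Qed.

Lemma fl_alcove p i : in_alcove D p -> (fl i)%:~R < qpair p (a i) < (fl i + 1)%:~R.
Proof.
move=> hp; rewrite /fl; case: posP => [/hp //|h].
have /hp : posc (negr i) by apply: negc_posc; case: (HB.2 i).
rewrite root_neg // qpairN => /andP[h1 h2].
by apply/andP; split; rewrite ?intrD ?mulrNz; lra.
Qed.

(* With [fl] the floor of the root [a i] on the alcove, [dep x i] is the floor of
   [a i] on the image of the alcove minus its floor on the alcove: the signed number of
   hyperplanes of direction [a i] crossed.  It is a cocycle in [x], see [depM]. *)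
Definition dep (x : elt n) (i : 'I_m) : int :=
  rpair x.1 (a i) + fl (ract x.2 i) - fl i.

Lemma qpair_eact_bounds x i p : raut D x.2 -> in_alcove D p ->
  (dep x i + fl i)%:~R < qpair (eact x p) (a i) < (dep x i + fl i + 1)%:~R.
Proof.
move=> hx hp; rewrite qpair_eact -ractE // /dep subrK.
have /andP[h1 h2] := fl_alcove (ract x.2 i) hp.
apply/andP; split; first by rewrite intrD ltrD2l.
by rewrite -addrA intrD ltrD2l.
Qed.

Lemma depM x y i : raut D x.2 -> raut D y.2 ->
  dep (emul x y) i = dep x i + dep y (ract x.2 i).
Proof.
move=> hx hy; rewrite /dep /= rpairDl rpairM ractM // ractE //; ring.
Qed.

Lemma dep_neg x i : raut D x.2 -> dep x (negr i) = - dep x i.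
Proof.
by move=> hx; rewrite /dep ract_neg // root_neg // rpairNr !fl_neg; ring.
Qed.

Definition len (x : elt n) : nat := \sum_(i | pos i) `|dep x i|%N.

(** Opposite roots have opposite depths. Summing over all roots doubles the length, but gives a sum
    that any automorphism of the roots may reindex. *)
Lemma sum_dep x : raut D x.2 -> (\sum_i `|dep x i|)%N = (len x).*2.
Proof.
move=> hx; rewrite (bigID pos) /= -addnn; congr (_ + _)%N.
rewrite (reindex_inj (inv_inj (negrK HD))) /=.
apply: eq_big => i; first by rewrite pos_neg negbK.
by move=> _; rewrite dep_neg // abszN.
Qed.

Lemma separatesE x (i : 'I_m) k : raut D x.2 -> pos i ->
  separates x i k <-> k \in kseq (dep x i).
Proof.
move=> hx hi; rewrite mem_kseq.
have e p : in_alcove D p -> ((qpair p (a i) - k%:~R) * (qpair (eact x p) (a i) - k%:~R) < 0) =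
    ((0 < k <= dep x i) || (dep x i < k <= 0)).
  move=> hp; have h1 := fl_alcove i hp; have h2 := qpair_eact_bounds i hx hp.
  rewrite /fl hi !addr0 in h1 h2; have [hk|hk] := leP k 0.
    rewrite pmulr_rlt0 ?subr_gt0 ?(gt_floor _ h1) // subr_lt0 (lt_floor _ h2) /=.
    by rewrite andbT.
  rewrite nmulr_rlt0 ?subr_lt0 ?(lt_floor _ h1) // subr_gt0 (gt_floor _ h2) /=.
  by rewrite andbF orbF.
split; first by move/(_ _ Hp0); rewrite e.
by move=> h p hp; rewrite e.
Qed.

(** The separating levels of a positive root are [kseq (dep x i)], and a duplicate-free list is
    determined up to order by its members. *)
Lemma has_lengthE x N : raut D x.2 -> has_length D x N <-> N = len x.
Proof.
move=> hx.
pose L := [seq (i, k) | i <- enum pos, k <- kseq (dep x i)].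
have uL : uniq L.
  apply: allpairs_uniq_dep => [|i _|]; rewrite ?enum_uniq ?uniq_kseq //.
  by move=> [i k] [j l] _ _ /= [-> ->].
have mL i k : (i, k) \in L <-> posc i /\ separates x i k.
  split.
    move=> /allpairsPdep [j [l [h1 h2 [-> ->]]]]; rewrite mem_enum in h1.
    by split; [apply/posP|apply/separatesE].
  move=> [/posP h1 /(separatesE _ hx h1) h2]; apply/allpairsPdep.
  by exists i, k; rewrite mem_enum.
have sL : size L = len x.
  rewrite size_allpairs_dep sumnE big_map big_enum /=.
  by apply: eq_bigr => i _; rewrite size_kseq.
split; last by move=> ->; exists L.
move=> [s [us [<- hs]]]; rewrite -sL; apply: perm_size; apply: uniq_perm => //.
move=> [i k]; apply/idP/idP; first by move/hs/mL.
by move/mL/hs.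
Qed.

Lemma len0P x : raut D x.2 -> reflect (forall i, dep x i = 0) (len x == 0)%N.
Proof.
move=> hx; rewrite -double_eq0 -sum_dep // sum_nat_eq0.
apply: (iffP forallP) => h i; last by rewrite h.
by have := h i; rewrite ?implyTb absz_eq0 => /eqP.
Qed.

Lemma lenM_add x y : raut D x.2 -> raut D y.2 ->
  (forall i, 0 <= dep x i * dep y (ract x.2 i)) ->
  len (emul x y) = (len x + len y)%N.
Proof.
move=> hx hy h; apply: double_inj; rewrite doubleD -!sum_dep //=; last exact: rautM.
rewrite [X in (_ + X)%N](reindex_inj (ract_inj HD hx)) -big_split /=.
by apply: eq_bigr => i _; rewrite depM //; have := h i; nia.
Qed.

Definition areflection (i : 'I_m) (k : int) : elt n := (k *: ac i, refl i).

Lemma dep_areflection i k j :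
  dep (areflection i k) j = k * rpair (ac i) (a j) + fl (sroot i j) - fl j.
Proof. by rewrite /dep rpairZl ract_refl. Qed.

Lemma areflectionK i k : emul (areflection i k) (areflection i k) = eone n.
Proof.
rewrite /emul /eone /areflection /= refl_refl //; congr (_, _).
rewrite -scalemxAr coroot_refl rpair_root // scaler_nat mulr2n opprD addrA subrr.
by rewrite add0r scalerN subrr.
Qed.

(** The hyperplane [a i = k] is a wall of the alcove: reflecting in it crosses no other
    hyperplane. *)
Definition is_wall (i : 'I_m) (k : int) : Prop :=
  `|dep (areflection i k) i|%N = 1%N /\
  forall j, dep (areflection i k) j != 0 -> j = i \/ j = negr i.

Lemma negr_neq (i : 'I_m) : negr i != i.
Proof. by apply/eqP => h; have := pos_neg i; rewrite h; case: pos. Qed.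

Lemma sum_pair (F : 'I_m -> nat) (i : 'I_m) :
  (\sum_j F j = F i + F (negr i) + \sum_(j | (j != i) && (j != negr i)) F j)%N.
Proof. by rewrite (bigD1 i) //= (bigD1 (negr i)) ?negr_neq //= addnA. Qed.

Lemma raut_areflection i k : raut D (areflection i k).2.
Proof. exact: raut_refl. Qed.
Hint Resolve raut_areflection : core.

Lemma len_wall i k : is_wall i k -> len (areflection i k) = 1%N.
Proof.
move=> [h1 h2]; apply: double_inj; rewrite -sum_dep // (sum_pair _ i).
rewrite dep_neg // abszN h1 big1 // => j /andP[hj hj'].
apply/eqP; rewrite absz_eq0; apply/eqP; apply: contraNeq hj => /h2 [->//|h].
by rewrite h eqxx in hj'.
Qed.

(** The reflection permutes the depths of [x] at all roots but [i] and [negr i], so the length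
    changes through that pair only. *)
Lemma len_wallM x i k : raut D x.2 -> is_wall i k ->
  (len (emul (areflection i k) x) + `|dep x i| =
   len x + `|dep x i - dep (areflection i k) i|)%N.
Proof.
move=> hx [h1 h2]; apply: double_inj; rewrite !doubleD -!sum_dep //=; last first.
  by apply: rautM => //; apply: raut_areflection.
set s := areflection i k in h1 h2 *.
have rs : raut D s.2 by exact: raut_areflection.
have hs j : ract s.2 j = sroot i j := ract_refl HD i j.
rewrite (sum_pair _ i) [X in (_ = X + _)%N](sum_pair _ i).
set A := (\sum_(j | _) _)%N; set B := (\sum_(j | _) _)%N.
have -> : A = B.
  rewrite /A /B [RHS](reindex_inj (inv_inj (srootK HD i))) /=.
  apply: eq_big => j.
    have -> : negr i = sroot i i by [].
    rewrite (inv_eq (srootK HD i)) (can_eq (srootK HD i)).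
    by rewrite [in RHS]andbC.
  move=> /andP[hj hj']; rewrite depM // hs.
  have [->|/h2 [] e] := eqVneq (dep s j) 0; first by rewrite add0r.
    by rewrite e eqxx in hj.
  by rewrite e eqxx in hj'.
have hi : sroot i (negr i) = i by rewrite /negr srootK.
have hi' : sroot i i = negr i by [].
rewrite !depM // !hs hi hi' !dep_neg //; lia.
Qed.
End Length.

(** * Exchange property *)

Lemma scalemx_inj0 (R : idomainType) m n (k : R) (A : 'M[R]_(m, n)) :
  k != 0 -> k *: A = 0 -> A = 0.
Proof.
move=> k0 /matrixP h; apply/matrixP => i j; have := h i j; rewrite !mxE => /eqP.
by rewrite mulf_eq0 (negbTE k0) => /eqP.
Qed.

(** * An invariant quadratic form on the roots *)

Section RootNorm.
Variables (n : nat) (D : rdatum n).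
Local Notation m := (nroots D).
Local Notation a := (@Defs.root n D).
Local Notation ac := (@Defs.coroot n D).
Hypothesis HD : is_root_datum D.

(** An invariant squared length: reflections permute the coroots, hence the summands. *)
Definition root_norm (i : 'I_m) : int := \sum_l rpair (ac l) (a i) ^+ 2.
Definition coroot_norm (i : 'I_m) : int := \sum_l rpair (ac i) (a l) ^+ 2.

Lemma root_norm_gt0 i : 0 < root_norm i.
Proof.
rewrite /root_norm (bigD1 i) //= rpair_root //; apply: ltr_pwDl => //.
by apply: sumr_ge0 => l _; apply: sqr_ge0.
Qed.

Lemma coroot_norm_gt0 i : 0 < coroot_norm i.
Proof.
rewrite /coroot_norm (bigD1 i) //= rpair_root //; apply: ltr_pwDl => //.
by apply: sumr_ge0 => l _; apply: sqr_ge0.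
Qed.

Lemma root_norm_sroot i j : root_norm (sroot i j) = root_norm j.
Proof.
rewrite /root_norm (reindex_inj (inv_inj (srootK HD i))) /=.
apply: eq_bigr => l _; case: (sroot_spec HD i l) => _ ->.
by case: (sroot_spec HD i j) => -> _; rewrite rpairM -mulmxA refl_refl // mulmx1.
Qed.

(** Reindexing [S] by the reflection in [i] turns it into [root_norm i *: ac i - S]. *)
Lemma sum_coroot i : 2 *: (\sum_l rpair (ac l) (a i) *: ac l) = root_norm i *: ac i.
Proof.
set S := \sum_l _.
have e : S = root_norm i *: ac i - S.
  rewrite {1}/S (reindex_inj (inv_inj (srootK HD i))) /= /root_norm scaler_suml.
  rewrite -sumrB; apply: eq_bigr => l _; case: (sroot_spec HD i l) => _ ->.
  rewrite rpairM root_refl rpair_root //.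
  rewrite (_ : a i - 2 *: a i = - a i); last first.
    by rewrite scaler_nat mulr2n opprD addrA subrr add0r.
  by rewrite rpairNr coroot_refl scaleNr scalerBr opprB scalerA -expr2.
by rewrite scaler_nat mulr2n {1}e subrK.
Qed.

Lemma sum_root i : 2 *: (\sum_l rpair (ac i) (a l) *: a l) = coroot_norm i *: a i.
Proof.
set S := \sum_l _.
have e : S = coroot_norm i *: a i - S.
  rewrite {1}/S (reindex_inj (inv_inj (srootK HD i))) /= /coroot_norm scaler_suml.
  rewrite -sumrB; apply: eq_bigr => l _; case: (sroot_spec HD i l) => -> _.
  rewrite -rpairM coroot_refl rpair_root //.
  rewrite (_ : ac i - 2 *: ac i = - ac i); last first.
    by rewrite scaler_nat mulr2n opprD addrA subrr add0r.
  by rewrite rpairNl root_refl scaleNr scalerBr opprB scalerA -expr2.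
by rewrite scaler_nat mulr2n {1}e subrK.
Qed.

Lemma root_form i j :
  2 * \sum_l rpair (ac l) (a i) * rpair (ac l) (a j) = root_norm i * rpair (ac i) (a j).
Proof.
rewrite -rpairZl -sum_coroot rpairZl rpair_suml; congr (_ * _).
by apply: eq_bigr => l _; rewrite rpairZl.
Qed.

(* A combination of roots killed by all coroots is zero: it is [\sum_l <y, a_l> a_l]
   for some [y] in the coroot span, and pairing it with [y] gives a sum of squares. *)
Lemma root_comb_eq0 (c c' : int) i j :
  (forall l, rpair (ac l) (c *: a i + c' *: a j) = 0) -> c *: a i + c' *: a j = 0.
Proof.
set u := _ + _ => hu.
(* The weights are chosen so that [sum_root] gives both roots the same factor
   [coroot_norm i * coroot_norm j]. *)
pose y := (c * coroot_norm j) *: ac i + (c' * coroot_norm i) *: ac j.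
have hy : 2 *: (\sum_l rpair y (a l) *: a l) = (coroot_norm i * coroot_norm j) *: u.
  have -> : \sum_l rpair y (a l) *: a l =
     (c * coroot_norm j) *: (\sum_l rpair (ac i) (a l) *: a l) +
     (c' * coroot_norm i) *: (\sum_l rpair (ac j) (a l) *: a l).
    rewrite !scaler_sumr -big_split /=; apply: eq_bigr => l _.
    by rewrite /y rpairDl !rpairZl scalerDl !scalerA.
  rewrite scalerDr !scalerA ![2 * _]mulrC -!scalerA !sum_root /u !scalerDr !scalerA.
  by congr (_ *: _ + _ *: _); ring.
have h0 : rpair y u = 0 by rewrite /y rpairDl !rpairZl !hu !mulr0 addr0.
have h1 : \sum_l rpair y (a l) ^+ 2 = 0.
  have : 2 * \sum_l rpair y (a l) ^+ 2 = 0.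
    transitivity (rpair y (2 *: (\sum_l rpair y (a l) *: a l))).
      rewrite rpairZr rpair_sumr; congr (_ * _); apply: eq_bigr => l _.
      by rewrite rpairZr expr2.
    by rewrite hy rpairZr h0 mulr0.
  by lia.
have h2 l : rpair y (a l) = 0.
  apply/eqP; rewrite -sqrf_eq0; apply/eqP.
  by have /psumr_eq0P := h1 => ->// k _; apply: sqr_ge0.
have := hy; rewrite big1 => [|l _]; last by rewrite h2 scale0r.
rewrite scaler0 => /esym; apply: scalemx_inj0.
by rewrite mulf_neq0 // gt_eqF ?coroot_norm_gt0.
Qed.

(** With [k = <ac_i, a_j>], the invariant squared length of [2 a_j - k a_i] is
    [4 |a_j|^2 - k^2 |a_i|^2], so it must vanish and [2 a_j = k a_i]. Pairing with [ac j] shows that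
    [k] divides 4, and reducedness leaves only [k = 2]. *)
Lemma root_rigid i j : 0 < rpair (ac i) (a j) ->
  4 * root_norm j <= rpair (ac i) (a j) ^+ 2 * root_norm i -> j = i.
Proof.
set k := rpair _ _ => k0 h.
have hu l : rpair (ac l) (2 *: a j + (- k) *: a i) = 0.
  have : \sum_l rpair (ac l) (2 *: a j + (- k) *: a i) ^+ 2 <= 0.
    have -> : \sum_l rpair (ac l) (2 *: a j + (- k) *: a i) ^+ 2 =
       4 * root_norm j - 2 * k * (2 * \sum_l rpair (ac l) (a i) * rpair (ac l) (a j))
         + k ^+ 2 * root_norm i.
      rewrite /root_norm !mulr_sumr -sumrB -big_split /=; apply: eq_bigr => l' _.
      by rewrite rpairDr !rpairZr; ring.
    rewrite root_form -/k; lia.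
  move=> hle; apply/eqP; rewrite -sqrf_eq0; apply/eqP.
  have /psumr_eq0P : \sum_l rpair (ac l) (2 *: a j + (- k) *: a i) ^+ 2 = 0.
    by apply/eqP; rewrite eq_le hle sumr_ge0 // => l' _; apply: sqr_ge0.
  by move=> ->// l' _; apply: sqr_ge0.
have e := root_comb_eq0 hu.
have h4 : k * rpair (ac j) (a i) = 4.
  have := hu j; rewrite rpairDr !rpairZr rpair_root //; lia.
have e2 : 2 *: a j = k *: a i by apply/eqP; rewrite -subr_eq0 -scaleNr e.
have [k1|[k2|k4]] : k = 1 \/ k = 2 \/ k = 4.
  move: k0 h4; move: (rpair (ac j) (a i)) => l; move: k {h hu e e2} => k k0 h4.
  have l0 : 0 < l by rewrite -(pmulr_rgt0 _ k0) h4.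
  have k4 : k <= 4 by rewrite -h4 -[X in X <= _]mulr1 ler_pM2l // -gtz0_ge1.
  have : k = 1 \/ k = 2 \/ k = 3 \/ k = 4 by lia.
  by case=> [|[|[k3|]]]; [left|right; left|rewrite k3 in h4; lia|right; right].
- by case: (root_reduced HD (i := j) (j := i)); rewrite e2 k1 scale1r.
- apply: (root_inj HD); apply/eqP; rewrite -subr_eq0; apply/eqP.
  have : 2 *: (a j - a i) = 0 by rewrite scalerBr e2 k2 subrr.
  exact: scalemx_inj0.
case: (root_reduced HD (i := i) (j := j)); apply/eqP; rewrite -subr_eq0; apply/eqP.
have : 2 *: (a j - 2 *: a i) = 0 by rewrite scalerBr e2 k4 scalerA subrr.
exact: scalemx_inj0.
Qed.

End RootNorm.

Lemma seq_argmin (T : eqType) (F : T -> rat) (s : seq T) (x0 : T) : x0 \in s ->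
  exists2 x, x \in s & forall y, y \in s -> F x <= F y.
Proof.
elim: s x0 => // y s IH x0 _; case: s IH => [_|z s IH].
  by exists y; rewrite ?mem_seq1 // => u; rewrite mem_seq1 => /eqP ->.
have [x hx hm] := IH z (mem_head _ _).
have [h|h] := leP (F x) (F y).
  exists x; first by rewrite inE hx orbT.
  by move=> u; rewrite inE => /orP[/eqP->//|/hm].
exists y; first exact: mem_head.
move=> u; rewrite inE => /orP[/eqP->//|/hm]; apply: le_trans; exact: ltW.
Qed.

(** * Crossed affine roots and walls of the alcove *)

Section Exchange.
Variables (n : nat) (D : rdatum n) (p0 : 'cV[rat]_n).
Local Notation m := (nroots D).
Local Notation a := (@Defs.root n D).
Local Notation ac := (@Defs.coroot n D).
Hypothesis (HD : is_root_datum D) (HB : is_base D) (Hp0 : in_alcove D p0).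
Local Notation dep := (dep p0).
Local Notation fl := (fl p0).
Local Notation len := (len D p0).

(* [(i, k)] stands for the affine function [a i - k]. *)
Definition affroot (f : 'I_m * int) (z : 'cV[rat]_n) : rat := qpair z (a f.1) - f.2%:~R.

Lemma affroot_gt0 f : (0 < affroot f p0) = (f.2 <= fl f.1).
Proof. by rewrite subr_gt0 (gt_floor _ (fl_alcove HD HB Hp0 _ Hp0)). Qed.

Lemma affroot_eact_lt0 x f : raut D x.2 ->
  (affroot f (eact x p0) < 0) = (dep x f.1 + fl f.1 < f.2).
Proof.
by move=> hx; rewrite subr_lt0 (lt_floor _ (qpair_eact_bounds HD HB Hp0 _ hx Hp0)).
Qed.

(** Levels positive at [p0] start at [fl i] and go down, and at most [|dep x i|] of them are
    crossed, so this finite list misses none. *)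
Definition crossed (x : elt n) : seq ('I_m * int) :=
  [seq f <- [seq (i, fl i - Posz t) | i <- enum 'I_m, t <- iota 0 `|dep x i|] |
     (0 < affroot f p0) && (affroot f (eact x p0) < 0)].

Lemma mem_crossed x f : raut D x.2 ->
  (f \in crossed x) = (0 < affroot f p0) && (affroot f (eact x p0) < 0).
Proof.
move=> hx; rewrite mem_filter; apply: andb_idr => /andP[].
rewrite affroot_gt0 affroot_eact_lt0 //; case: f => i k /= h1 h2.
apply/allpairsPdep; exists i, `|fl i - k|%N; split; rewrite ?mem_enum //.
  by rewrite mem_iota; lia.
congr (_, _); lia.
Qed.

(* The opposite of [g] composed with the reflection in [f]. *)
Definition arefl_root (f g : 'I_m * int) : 'I_m * int :=
  (negr (sroot f.1 g.1), f.2 * rpair (ac f.1) (a g.1) - g.2).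

Lemma affroot_arefl f g z :
  affroot g z + affroot (arefl_root f g) z = (rpair (ac f.1) (a g.1))%:~R * affroot f z.
Proof.
rewrite /affroot /= root_neg // qpairN; case: (sroot_spec HD f.1 g.1) => -> _.
rewrite root_refl qpairD -scaleNr qpairZ intrB intrM mulrNz; ring.
Qed.

Lemma affroot_areflection (f g : 'I_m * int) z :
  affroot g (eact (areflection f.1 f.2) z) = - affroot (arefl_root f g) z.
Proof.
rewrite /affroot qpair_eact /= rpairZl root_neg // qpairN.
by case: (sroot_spec HD f.1 g.1) => -> _; rewrite intrB; ring.
Qed.

(** The reflection in [f] makes a [g] positive at [p0] negative exactly when [arefl_root f g] is
    positive at [p0]; so by hypothesis it crosses [f] alone. *)
Lemma is_wall_crit (f : 'I_m * int) : 0 < affroot f p0 ->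
  (forall g, 0 < affroot g p0 -> 0 < affroot (arefl_root f g) p0 -> g = f) ->
  is_wall p0 f.1 f.2 /\ dep (areflection f.1 f.2) f.1 = -1.
Proof.
case: f => i k /= h0 hg; set s := areflection i k.
have rs : raut D s.2 by exact: raut_areflection.
have hneg j : dep s j < 0 -> j = i /\ dep s j = -1.
  move=> hj.
  have H l : l <= fl j -> dep s j + fl j < l -> j = i /\ l = k.
    move=> h1 h2; have [] : (j, l) = (i, k); last by [].
    apply: hg; first by rewrite affroot_gt0.
    by rewrite -oppr_lt0 -affroot_areflection affroot_eact_lt0.
  (* The two extreme levels crossed in direction [j] both equal [k], so only one is crossed. *)
  have [e1 e2] : j = i /\ fl j = k by apply: H; lia.
  have [_ e3] : j = i /\ dep s j + fl j + 1 = k by apply: H; lia.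
  by split=> //; lia.
(* This depth is [2 k - 1 - 2 fl i], which is odd. *)
have hi0 : dep s i != 0.
  rewrite dep_areflection // rpair_root // -/(negr i) fl_neg //; lia.
have hi : dep s i = -1.
  have [/hneg[]//|] := ltP (dep s i) 0; rewrite le_eqVlt eq_sym (negbTE hi0) /= => h.
  have [|e] := hneg (negr i); first by rewrite dep_neg // oppr_lt0.
  by have := negr_neq HD HB Hp0 i; rewrite e eqxx.
split=> //; split=> [|j hj]; first by rewrite hi.
have [/hneg[->]|] := ltP (dep s j) 0; first by left.
rewrite le_eqVlt eq_sym (negbTE hj) /= => h; right.
have [|e _] := hneg (negr j); first by rewrite dep_neg // oppr_lt0.
by rewrite -e negrK.
Qed.

Lemma exchange x : raut D x.2 -> len x != 0%N ->
  exists (i : 'I_m) k, is_wall p0 i k /\ len x = (len (emul (areflection i k) x)).+1.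
Proof.
move=> hx hl; pose q := eact x p0.
(* The parameter at which a crossed [f] vanishes on the segment from [p0] to [q]. *)
pose time (f : 'I_m * int) := affroot f p0 / (affroot f p0 - affroot f q).
have [f0 hf0] : exists f, f \in crossed x.
  have [i hi] : exists i : 'I_m, dep x i < 0.
    apply/existsP; apply: contraR hl => /existsPn h; apply/(len0P HD HB Hp0 hx) => i.
    have := h i; have := h (negr i); rewrite dep_neg //; lia.
  exists (i, fl i); rewrite mem_crossed // affroot_gt0 affroot_eact_lt0 //=; lia.
have [f1] := seq_argmin time hf0.
rewrite mem_crossed // => /andP[f1p f1q] hmin; set t := time f1 in hmin.
have hden : 0 < affroot f1 p0 - affroot f1 q by rewrite subr_gt0 (lt_trans f1q).
have t0 : 0 < t by rewrite divr_gt0.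
have t1 : t < 1 by rewrite ltr_pdivrMr // mul1r ltrDl oppr_gt0.
(* The value of [f] at the point of the segment where the first crossing happens; affine roots
   positive at [p0] are still nonnegative there. *)
pose val (f : 'I_m * int) := (1 - t) * affroot f p0 + t * affroot f q.
have val_ge0 f : 0 < affroot f p0 -> 0 <= val f.
  move=> fp; have [fq|fq] := leP 0 (affroot f q).
    by rewrite addr_ge0 // mulr_ge0 // ?ltW // subr_gt0.
  have hd : 0 < affroot f p0 - affroot f q by rewrite subr_gt0 (lt_trans fq).
  have := hmin f; rewrite mem_crossed // fp fq => /(_ isT).
  by rewrite /(time f) ler_pdivlMr // /val; lra.
have val_f1 : val f1 = 0.
  have : t * (affroot f1 p0 - affroot f1 q) = affroot f1 p0 by rewrite divfK ?gt_eqF.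
  by rewrite /val; lra.
have val_crossed f : 0 < affroot f p0 -> val f = 0 -> f \in crossed x.
  move=> fp fv; rewrite mem_crossed // fp /=.
  have h1 : 0 < (1 - t) * affroot f p0 by rewrite mulr_gt0 // subr_gt0.
  by rewrite -(pmulr_rlt0 _ t0); move: fv; rewrite /val -/q; lra.
(* The squared distance from [p0] to the hyperplane of [f] for the invariant form; it selects among
   the hyperplanes met first. *)
pose dist (f : 'I_m * int) : rat := affroot f p0 ^+ 2 / (root_norm f.1)%:~R.
have norm_gt0 (i : 'I_m) : 0 < (root_norm i)%:~R :> rat by rewrite ltr0z; exact: root_norm_gt0.
have f1R : f1 \in [seq f <- crossed x | val f == 0].
  by rewrite mem_filter val_f1 eqxx val_crossed.
have [f] := seq_argmin dist f1R.
rewrite mem_filter mem_crossed // => /andP[/eqP fv /andP[fp fq]] hfmin.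
(* If [g] and [g'] are positive at [p0], they are nonnegative at the crossing point, where their sum
   is a multiple of [val f = 0]; so both vanish there, and minimality of [f] leads to
   [root_rigid]. *)
have hcrit g : 0 < affroot g p0 -> 0 < affroot (arefl_root f g) p0 -> g = f.
  move=> gp gp'; set g' := arefl_root f g in gp'.
  have hs z : affroot g z + affroot g' z = (rpair (ac f.1) (a g.1))%:~R * affroot f z.
    exact: affroot_arefl.
  set k := rpair _ _ in hs.
  have hv : val g + val g' = 0.
    transitivity (k%:~R * val f); last by rewrite fv mulr0.
    transitivity ((1 - t) * (k%:~R * affroot f p0) + t * (k%:~R * affroot f q)).
      by rewrite -!hs /val; ring.
    by rewrite /val; ring.
  have gv : val g = 0 by have := val_ge0 _ gp; have := val_ge0 _ gp'; lra.
  have gv' : val g' = 0 by have := val_ge0 _ gp; have := val_ge0 _ gp'; lra.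
  have hd g1 : 0 < affroot g1 p0 -> val g1 = 0 -> dist f <= dist g1.
    by move=> h1 h2; apply: hfmin; rewrite mem_filter h2 eqxx val_crossed.
  have := hd _ gp gv; have := hd _ gp' gv'; rewrite /dist.
  have -> : root_norm g'.1 = root_norm g.1 by rewrite /g' /= /negr !(root_norm_sroot HD).
  rewrite !ler_pdivlMr //.
  set Nf : rat := (root_norm f.1)%:~R; set Ng : rat := (root_norm g.1)%:~R.
  move=> h1 h2.
  have k0 : 0 < k.
    have : 0 < k%:~R * affroot f p0 by rewrite -hs addr_gt0.
    by rewrite pmulr_lgt0 // ltr0z.
  (* With [A, B, B'] the values of [f, g, g'] at [p0], minimality bounds [u] by [B^2] and [B'^2],
     hence [4 u <= 4 B B' <= (B + B')^2 = k^2 A^2]. *)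
  have hN : 4 * root_norm g.1 <= k ^+ 2 * root_norm f.1.
    set A := affroot f p0 in fp h1 h2; have eB := hs p0; rewrite -/A in eB.
    set B := affroot g p0 in gp h2 eB; set B' := affroot g' p0 in gp' h1 eB.
    set u := A ^+ 2 / Nf * Ng in h1 h2.
    have u0 : 0 <= u by rewrite mulr_ge0 ?divr_ge0 ?sqr_ge0 // ltW // norm_gt0.
    have hu : u <= B * B'.
      have : u ^+ 2 <= (B * B') ^+ 2 by rewrite [(B * B') ^+ 2]exprMn [u ^+ 2]expr2 ler_pM.
      by rewrite ler_sqr // nnegrE mulr_ge0 // ltW.
    have h4 : 4 * u <= (k%:~R * A) ^+ 2 by rewrite -eB; lra.
    have eu : u * Nf = A ^+ 2 * Ng by rewrite /u mulrAC divfK // gt_eqF // norm_gt0.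
    have : 4 * Ng * A ^+ 2 <= k%:~R ^+ 2 * Nf * A ^+ 2.
      have -> : 4 * Ng * A ^+ 2 = 4 * u * Nf by rewrite -[RHS]mulrA eu; ring.
      have -> : k%:~R ^+ 2 * Nf * A ^+ 2 = (k%:~R * A) ^+ 2 * Nf by ring.
      by rewrite ler_pM2r // norm_gt0.
    rewrite ler_pM2r ?exprn_gt0 // -(ler_int rat).
    by rewrite [k ^+ 2]expr2 [k%:~R ^+ 2]expr2 !intrM.
  have e : g.1 = f.1 by apply: (root_rigid HD).
  (* Equal linear parts and a common zero force equal levels. *)
  have e2 : g.2 = f.2.
    have : val g - val f = (f.2 - g.2)%:~R.
      by rewrite /val /affroot e intrB; ring.
    rewrite gv fv subrr => /esym/eqP; rewrite intr_eq0 => /eqP; lia.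
  by case: (f) (g) e e2 => [? ?] [? ?] /= -> ->.
have [hw hd] := is_wall_crit fp hcrit.
exists f.1, f.2; split=> //.
have := len_wallM HD HB Hp0 hx hw; rewrite hd.
have : dep x f.1 < 0.
  move: fp fq; rewrite affroot_gt0 (affroot_eact_lt0 _ hx) => fp fq.
  by rewrite -(ltrD2r (fl f.1)) add0r; apply: (lt_le_trans fq).
by move: (len x) (len _) (dep x _) => u v w; lia.
Qed.

End Exchange.

(** * The extended affine Weyl group *)

Lemma invmx_mul (R : comUnitRingType) k (A B : 'M[R]_k) :
  A \in unitmx -> B \in unitmx -> invmx (A *m B) = invmx B *m invmx A.
Proof.
move=> uA uB; have uAB : A *m B \in unitmx by rewrite unitmx_mul uA.
apply: (can_inj (mulKmx uAB)).
by rewrite mulmxV // mulmxA -(mulmxA A) mulmxV // mulmx1 mulmxV.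
Qed.

Section EltMonoid.
Variable n : nat.
Implicit Types x y z : elt n.

Lemma emulA : associative (@emul n).
Proof. by move=> x y z; rewrite /emul /= mulmxDr !mulmxA addrA. Qed.
Lemma emul1e x : emul (eone n) x = x.
Proof. by case: x => l g; rewrite /emul /= !mul1mx add0r. Qed.
Lemma emule1 x : emul x (eone n) = x.
Proof. by case: x => l g; rewrite /emul /= mulmx1 mulmx0 addr0. Qed.

Definition einv x : elt n := (- (invmx x.2 *m x.1), invmx x.2).
Lemma emulV x : x.2 \in unitmx -> emul x (einv x) = eone n.
Proof.
by move=> hx; rewrite /emul /= mulmxN mulmxA mulmxV // mul1mx subrr.
Qed.
Lemma emulVe x : x.2 \in unitmx -> emul (einv x) x = eone n.
Proof. by move=> hx; rewrite /emul /= mulVmx // addNr. Qed.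

Definition epow x k : elt n := iter k (emul x) (eone n).
Lemma epowS x k : epow x k.+1 = emul x (epow x k).
Proof. by []. Qed.
Lemma epowSr x k : epow x k.+1 = emul (epow x k) x.
Proof.
elim: k => [|k IH]; first by rewrite /epow /= emul1e emule1.
by rewrite epowS {1}IH emulA.
Qed.
Lemma epow1 x : epow x 1 = x.
Proof. by rewrite epowS emule1. Qed.
End EltMonoid.

Section ExtendedWeylGroup.
Variables (n : nat) (D : rdatum n) (Om : seq 'M[int]_n).
Local Notation m := (nroots D).
Local Notation a := (@Defs.root n D).
Local Notation ac := (@Defs.coroot n D).
Hypothesis (HD : is_root_datum D) (HOm : is_diag_group D Om).

Lemma inW0_refl (i : 'I_m) : inW0 D (refl i).
Proof. by exists [:: i]; rewrite /= mulmx1. Qed.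
Lemma inW0_1 : inW0 D 1%:M.
Proof. by exists [::]. Qed.
Lemma inW0M w w' : inW0 D w -> inW0 D w' -> inW0 D (w *m w').
Proof.
move=> [l ->] [l' ->]; exists (l ++ l').
by elim: l => [|i l IH] /=; rewrite ?mul1mx // -mulmxA IH.
Qed.
Lemma inW0_raut w : inW0 D w -> raut D w.
Proof.
move=> [l ->]; elim: l => [|i l IH] /=; first exact: raut1.
by apply: rautM => //; apply: raut_refl.
Qed.
Lemma inW0V w : inW0 D w -> inW0 D (invmx w).
Proof.
move=> [l ->]; elim: l => [|i l IH] /=; first by rewrite invmx1; apply: inW0_1.
have hi := raut_refl HD i.
have hl : raut D (foldr (fun i M => refl i *m M) 1%:M l) by apply: inW0_raut; exists l.
rewrite invmx_mul ?hi.1 ?hl.1 //; apply: inW0M => //.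
rewrite -[invmx (refl i)]mulmx1 -(refl_refl HD i) mulmxA mulVmx ?hi.1 // mul1mx.
exact: inW0_refl.
Qed.

Lemma diag_raut s : s \in Om -> raut D s.
Proof.
case: HOm => _ [_ h] /h [t [st [ts hi]]].
have [us ut] := mulmx1_unit st.
have rt : raut D t by split=> // i; have [j [hj _]] := hi i; exists j.
have -> : s = invmx t by rewrite -[s]mulmx1 -(mulmxV ut) mulmxA st mul1mx.
exact: rautV.
Qed.

(** A diagram automorphism carries each root and its coroot to another such pair, so it conjugates
    reflections to reflections. *)
Lemma inW0_conj s w : s \in Om -> inW0 D w -> inW0 D (s *m w *m invmx s).
Proof.
case: HOm => _ [_ h] /h [t [st [ts hi]]].
have [us ut] := mulmx1_unit st.
have -> : invmx s = t by rewrite -[t]mul1mx -(mulVmx us) -mulmxA st mulmx1.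
move=> [l ->]; elim: l => [|i l IH] /=; first by rewrite mulmx1 st; apply: inW0_1.
have -> M : s *m (refl i *m M) *m t = (s *m refl i *m t) *m (s *m M *m t).
  by rewrite !mulmxA -[in RHS](mulmxA (s *m refl i) t s) ts mulmx1.
apply: inW0M => //; have [j [hj [hj' _]]] := hi i.
have -> : s *m refl i *m t = refl j; last exact: inW0_refl.
by rewrite /refl hj hj' mulmxBr mulmxBl mulmx1 st !mulmxA.
Qed.

(** All powers of [s] lie in the finite list [Om], so two of them agree; cancelling shows that the
    inverse is itself a power of [s]. *)
Lemma diagV s : s \in Om -> invmx s \in Om.
Proof.
move=> hs; have us := (diag_raut hs).1.
have hp k : s ^+ k \in Om.
  by elim: k => [|k IH]; [case: HOm|rewrite exprS; apply: HOm.2.1].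
pose f (k : 'I_(size Om).+1) : 'I_(size Om) := Ordinal (etrans (index_mem (s ^+ k) Om) (hp k)).
have : ~ injective f by move=> /leq_card; rewrite !card_ord ltnn.
move=> hf; have [i [j [lij e]]] : exists i j, (i < j)%N /\ s ^+ i = s ^+ j.
  apply: contrapT => hc; apply: hf => i j /(congr1 val) /= e.
  have e2 : s ^+ i = s ^+ j by rewrite -(nth_index 0 (hp i)) e nth_index.
  by apply/val_inj/eqP; case: ltngtP => // h; case: hc; [exists i, j|exists j, i].
have e1 : s ^+ (j - i) = 1.
  have : s ^+ i * s ^+ (j - i) = s ^+ i by rewrite -exprD subnKC // ltnW.
  have ui : s ^+ i \in unitmx.
    by elim: (i : nat) => [|k IH]; rewrite ?unitmx1 // exprS unitmx_mul us.
  by move/(congr1 (mulmx (invmx (s ^+ i)))); rewrite mulmxA mulVmx // mul1mx.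
have -> : invmx s = s ^+ (j - i).-1; last exact: hp.
have : s * s ^+ (j - i).-1 = 1 by rewrite -exprS prednK // subn_gt0.
by move/(congr1 (mulmx (invmx s))); rewrite mulmxA mulVmx // mul1mx mulmx1.
Qed.

Local Notation G := (inWt D Om).

Lemma inWt_raut x : G x -> raut D x.2.
Proof.
by move=> [w [s [hw [hs ->]]]]; apply: rautM => //; [apply: inW0_raut|apply: diag_raut].
Qed.
Lemma inWt1 : G (eone n).
Proof.
by exists 1%:M, 1%:M; rewrite mulmx1; split; [exact: inW0_1|case: HOm].
Qed.
Lemma inWtM x y : G x -> G y -> G (emul x y).
Proof.
move=> [w [s [hw [hs e]]]] [w' [s' [hw' [hs' e']]]].
have us := (diag_raut hs).1.
exists (w *m (s *m w' *m invmx s)), (s *m s'); split; last split.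
- by apply: inW0M => //; apply: inW0_conj.
- exact: HOm.2.1.
by rewrite /= e e' !mulmxA -[in RHS](mulmxA _ (invmx s) s) mulVmx // mulmx1.
Qed.
Lemma inWtV x : G x -> G (einv x).
Proof.
move=> [w [s [hw [hs e]]]].
have us := (diag_raut hs).1; have uw := (inW0_raut hw).1.
exists (invmx s *m invmx w *m invmx (invmx s)), (invmx s); split; last split.
- by apply: inW0_conj; [apply: diagV|apply: inW0V].
- exact: diagV.
by rewrite /= e invmx_mul // invmxK mulmxK.
Qed.
Lemma inWt_epow x k : G x -> G (epow x k).
Proof. by move=> hx; elim: k => [|k IH]; [exact: inWt1|apply: inWtM]. Qed.
Lemma emulxV x : G x -> emul x (einv x) = eone n.
Proof. by move=> /inWt_raut hx; apply: emulV hx.1. Qed.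
Lemma emulVx x : G x -> emul (einv x) x = eone n.
Proof. by move=> /inWt_raut hx; apply: emulVe hx.1. Qed.
Lemma emulKV x y : G x -> emul (emul y (einv x)) x = y.
Proof. by move=> hx; rewrite -emulA emulVx // emule1. Qed.
Lemma emulK x y : G x -> emul (emul y x) (einv x) = y.
Proof. by move=> hx; rewrite -emulA emulxV // emule1. Qed.

Lemma inW_areflection (i : 'I_m) k : inW D (areflection i k).
Proof.
split; last exact: inW0_refl.
exists (fun j => if j == i then k else 0).
rewrite (bigD1 i) //= eqxx big1 ?addr0 // => j /negbTE ->.
by rewrite scale0r.
Qed.

Lemma inWt_areflection (i : 'I_m) k : G (areflection i k).
Proof.
exists (refl i), 1%:M; split; first exact: inW0_refl.
by rewrite /= mulmx1; split=> //; case: HOm.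
Qed.

(** The roots are permuted with finite order, and [N.+1] is that order. *)
Lemma exists_root_trivial_pow x : raut D x.2 ->
  exists N, forall i : 'I_m, ract (epow x N.+1).2 i = i.
Proof.
move=> hx; pose s := perm (ract_inj HD hx).
have hs k (i : 'I_m) : raut D (epow x k).2 /\ ract (epow x k).2 i = (s ^+ k)%g i.
  elim: k i => [|k IH] i.
    by split; [exact: raut1|rewrite expg0 perm1 /= ract1].
  have [h1 h2] := IH i; have e : (epow x k.+1).2 = (epow x k).2 *m x.2.
    by rewrite epowSr.
  by rewrite e; split; [apply: rautM|rewrite ractM // h2 expgSr permM permE].
exists #[s]%g.-1 => i; rewrite prednK ?order_gt0 //.
by rewrite (hs _ i).2 expg_order perm1.
Qed.
End ExtendedWeylGroup.

(** * Lengths along powers of an element acting trivially on the roots *)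

Section StableLength.
Variables (n : nat) (D : rdatum n) (p0 : 'cV[rat]_n).
Local Notation m := (nroots D).
Hypothesis (HD : is_root_datum D) (HB : is_base D) (Hp0 : in_alcove D p0).
Variables (g b : elt n).
Hypotheses (hg : raut D g.2) (hb : raut D b.2) (gb : emul g b = emul b g).
Hypothesis (b1 : forall i : 'I_m, ract b.2 i = i).

(* Along [g b^N] the depths grow linearly with slope those of [b], so for large [N]
   there is no cancellation left. *)
Lemma len_stable : exists N,
  len D p0 (emul (emul g (epow b N)) b) = (len D p0 (emul g (epow b N)) + len D p0 b)%N /\
  len D p0 (emul b (emul g (epow b N))) = (len D p0 b + len D p0 (emul g (epow b N)))%N.
Proof.
have hbg (i : 'I_m) : dep p0 b (ract g.2 i) = dep p0 b i.
  have /= := congr1 (fun x => dep p0 x i) gb; rewrite !depM // b1; lia.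
have rp N : raut D (epow b N).2 /\ forall i : 'I_m, ract (epow b N).2 i = i.
  elim: N => [|N [IH1 IH2]]; first by split; [exact: raut1|exact: ract1].
  by rewrite epowS; split=> [|i]; [apply: rautM|rewrite /= ractM // b1 IH2].
have hp N (i : 'I_m) : dep p0 (epow b N) i = N%:Z * dep p0 b i.
  elim: N => [|N IH]; first by rewrite /dep /= rpair0l ract1 // mul0r add0r subrr.
  by rewrite epowS depM ?b1 ?IH //; [lia|exact: (rp N).1].
have hN N (i : 'I_m) : dep p0 (emul g (epow b N)) i = dep p0 g i + N%:Z * dep p0 b i.
  by rewrite depM ?hp ?hbg //; exact: (rp N).1.
have rx N : raut D (emul g (epow b N)).2 by apply: rautM => //; exact: (rp N).1.
have hx N (i : 'I_m) : ract (emul g (epow b N)).2 i = ract g.2 i.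
  by rewrite /= ractM ?(rp N).2 //; exact: (rp N).1.
(* Twice the length bounds every [|dep g i|], so [N (dep b i)^2] outweighs the product of [dep g i]
   and [dep b i]. *)
exists (len D p0 g).*2.
have key (i : 'I_m) : 0 <= (dep p0 g i + ((len D p0 g).*2)%:Z * dep p0 b i) * dep p0 b i.
  have : (`|dep p0 g i| <= (len D p0 g).*2)%N.
    by rewrite -sum_dep // (bigD1 i) //= leq_addr.
  move: (_.*2) (dep _ _ _) (dep _ _ _) => N e d h.
  have [->|e0] := eqVneq e 0; first by rewrite mulr0.
  have : `|d| * `|e| <= N%:Z * (e * e).
    have -> : e * e = `|e| * `|e| by rewrite -normrM ger0_norm // -expr2 sqr_ge0.
    rewrite mulrA ler_wpM2r //; nia.
  by rewrite -normrM; lia.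
split; apply: lenM_add => // i; rewrite ?hx ?b1 hN ?hbg //.
by rewrite mulrC.
Qed.
End StableLength.

(** * The Hecke algebra modulo v - 1 *)

Section Commutators.
Variables (C : fieldType) (H : algType C).
Implicit Types x y z : H.

Definition comm x y := x * y - y * x.

Lemma commDl x x' y : comm (x + x') y = comm x y + comm x' y.
Proof. by rewrite /comm mulrDl mulrDr opprD addrACA. Qed.
Lemma commDr x y y' : comm x (y + y') = comm x y + comm x y'.
Proof. by rewrite /comm mulrDl mulrDr opprD addrACA. Qed.
Lemma commZl k x y : comm (k *: x) y = k *: comm x y.
Proof. by rewrite /comm -scalerAl -scalerAr scalerBr. Qed.
Lemma commZr k x y : comm x (k *: y) = k *: comm x y.
Proof. by rewrite /comm -scalerAl -scalerAr scalerBr. Qed.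
Lemma comm_suml I (r : seq I) (F : I -> H) y :
  comm (\sum_(i <- r) F i) y = \sum_(i <- r) comm (F i) y.
Proof. by rewrite /comm mulr_suml mulr_sumr -sumrB. Qed.
Lemma comm_sumr I (r : seq I) x (F : I -> H) :
  comm x (\sum_(i <- r) F i) = \sum_(i <- r) comm x (F i).
Proof. by rewrite /comm mulr_suml mulr_sumr -sumrB. Qed.
Lemma commMl x y z : comm (x * y) z = comm x (y * z) - comm (z * x) y.
Proof. by rewrite /comm !mulrA opprB addrA subrK. Qed.
Lemma commC0 x y : x * y = y * x -> comm x y = 0.
Proof. by rewrite /comm => ->; rewrite subrr. Qed.

Local Notation K := (@in_commutator C H).

Lemma commutator0 : K 0. Proof. by exists [::]; rewrite big_nil. Qed.
Lemma commutator_comm x y : K (comm x y).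
Proof. by exists [:: (x, y)]; rewrite big_seq1. Qed.
Lemma commutatorD x y : K x -> K y -> K (x + y).
Proof. by move=> [s ->] [t ->]; exists (s ++ t); rewrite big_cat. Qed.
Lemma commutatorZ k x : K x -> K (k *: x).
Proof.
move=> [s ->]; exists [seq (k *: p.1, p.2) | p <- s].
rewrite big_map scaler_sumr; apply: eq_bigr => p _ /=.
by rewrite -scalerAl -scalerAr scalerBr.
Qed.
Lemma commutatorM v x : (forall h, v * h = h * v) -> K x -> K (v * x).
Proof.
move=> hv [s ->]; exists [seq (v * p.1, p.2) | p <- s].
rewrite big_map mulr_sumr; apply: eq_bigr => p _ /=.
by rewrite mulrBr !mulrA -hv.
Qed.

End Commutators.

Section Hecke.
Variables (n : nat) (D : rdatum n) (Om : seq 'M[int]_n) (p0 : 'cV[rat]_n).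
Variables (C : numFieldType) (H : algType C) (T : elt n -> H) (V Vi : H).
Hypotheses (HD : is_root_datum D) (HB : is_base D) (HOm : is_diag_group D Om).
Hypotheses (Hp0 : in_alcove D p0) (HH : is_hecke D Om T V Vi).
Local Notation G := (inWt D Om).
Local Notation K := (@in_commutator C H).
Local Notation len := (len D p0).
Implicit Types (h : H) (x y z g : elt n).

Lemma VVi : V * Vi = 1. Proof. by case: HH. Qed.
Lemma ViV : Vi * V = 1. Proof. by case: HH => _ []. Qed.
Lemma Vcentral h : V * h = h * V. Proof. by case: HH => _ [_ []]. Qed.
Lemma T1 : T (eone n) = 1. Proof. by case: HH => _ [_ [_ [_ [_ []]]]]. Qed.
Lemma Vicentral h : Vi * h = h * Vi.
Proof. by rewrite -[LHS]mulr1 -VVi !mulrA -(mulrA Vi) -Vcentral mulrA ViV mul1r. Qed.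
Lemma V1central h : (V - 1) * h = h * (V - 1).
Proof. by rewrite mulrBl mulrBr Vcentral mul1r mulr1. Qed.

Lemma TM x y : G x -> G y -> len (emul x y) = (len x + len y)%N ->
  T (emul x y) = T x * T y.
Proof.
move=> hx hy e; case: HH => _ [_ [_ [_ [_ [_ [h _]]]]]].
have r z : G z -> has_length D z (len z).
  by move=> hz; apply/(has_lengthE HD HB Hp0) => //; apply: (inWt_raut HD HOm hz).
apply: (h _ _ _ _ hx hy (r _ hx) (r _ hy)); rewrite -e; apply: r.
exact: inWtM.
Qed.

Lemma T_wall_sqr (i : 'I_(nroots D)) k : is_wall p0 i k ->
  T (areflection i k) * T (areflection i k) = 1 + (V - Vi) * T (areflection i k).
Proof.
move=> hw; case: HH => _ [_ [_ [_ [_ [_ [_ h]]]]]].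
have hl : has_length D (areflection i k) 1.
  by apply/(has_lengthE HD HB Hp0); [exact: raut_refl|rewrite len_wall].
have := h _ (inW_areflection i k) hl; rewrite mulrDr !mulrBl.
set s := T _; rewrite -Vicentral VVi => /eqP; rewrite addr_eq0 opprB => /eqP e.
by rewrite -[LHS](subrK (V * s)) e -addrA [- _ + _]addrC.
Qed.

(** The two-sided ideal generated by [v - 1]; a congruence modulo [v - 1] is written
    [dv (h - h')]. *)
Definition dv h := exists c, h = (V - 1) * c.

Lemma dv0 : dv 0. Proof. by exists 0; rewrite mulr0. Qed.
Lemma dvD h h' : dv h -> dv h' -> dv (h + h').
Proof. by move=> [c ->] [c' ->]; exists (c + c'); rewrite mulrDr. Qed.
Lemma dvMl h h' : dv h -> dv (h' * h).
Proof. by move=> [c ->]; exists (h' * c); rewrite !mulrA V1central. Qed.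
Lemma dvMr h h' : dv h -> dv (h * h').
Proof. by move=> [c ->]; exists (c * h'); rewrite mulrA. Qed.
Lemma dv_trans h1 h2 h3 : dv (h1 - h2) -> dv (h2 - h3) -> dv (h1 - h3).
Proof. by move=> a b; have := dvD a b; rewrite addrA subrK. Qed.
Lemma dv_mul h1 h1' h2 h2' : dv (h1 - h1') -> dv (h2 - h2') -> dv (h1 * h2 - h1' * h2').
Proof.
move=> a b; apply: (@dv_trans _ (h1' * h2)); first by rewrite -mulrBl; apply: dvMr.
by rewrite -mulrBr; apply: dvMl.
Qed.

Lemma dvVVi : dv (V - Vi).
Proof.
exists (1 + Vi); rewrite mulrBl mul1r mulrDr mulr1 VVi opprD addrA.
by rewrite -[V + 1 - 1]addrA subrr addr0.
Qed.

Lemma T_wall_unit (i : 'I_(nroots D)) k : is_wall p0 i k ->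
  exists B, T (areflection i k) * B = 1 /\ B * T (areflection i k) = 1.
Proof.
move=> hw; have e := T_wall_sqr hw; exists (T (areflection i k) - (V - Vi)).
rewrite mulrBr mulrBl e addrK; split=> //.
by rewrite mulrBr -Vcentral -Vicentral -mulrBl addrK.
Qed.

(** By the exchange property, wall reflections can be split off on the left until the length is
    zero. *)
Lemma length_ind (P : elt n -> Prop) :
  (forall x, G x -> len x = 0%N -> P x) ->
  (forall (i : 'I_(nroots D)) k x, G x -> is_wall p0 i k ->
     len (emul (areflection i k) x) = (len x).+1 -> P x -> P (emul (areflection i k) x)) ->
  forall x, G x -> P x.
Proof.
move=> h0 hS x; move: {2}(len x) (erefl (len x)) => N; elim: N x => [|N IH] x e hx.
  exact: h0.
have [|i [k [hw ex]]] := exchange HD HB Hp0 (inWt_raut HD HOm hx); first by rewrite e.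
set s := areflection i k in ex; have hs : G s by apply: inWt_areflection.
have ex' : emul s (emul s x) = x by rewrite emulA areflectionK // emul1e.
rewrite -ex'; apply: hS; rewrite ?ex' //; first exact: inWtM.
by apply: IH; [rewrite ex in e; case: e|apply: inWtM].
Qed.

(** If the length goes up, the product is exact. Otherwise [T x = T s * T (s x)], and [T s * T s] is
    1 up to a multiple of [v - v^-1], hence of [v - 1]. *)
Lemma T_wallM (i : 'I_(nroots D)) k x : is_wall p0 i k -> G x ->
  dv (T (areflection i k) * T x - T (emul (areflection i k) x)).
Proof.
move=> hw hx; set s := areflection i k; have hs : G s by apply: inWt_areflection.
have hl := len_wallM HD HB Hp0 (inWt_raut HD HOm hx) hw; rewrite -/s in hl.
have ls : len s = 1%N by apply: len_wall.
have [h1|h1] : len (emul s x) = (len x).+1 \/ len x = (len (emul s x)).+1.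
- by have := hw.1; rewrite -/s; lia.
- by rewrite TM ?ls // subrr; apply: dv0.
have hsx : G (emul s x) by apply: inWtM.
have ex : emul s (emul s x) = x by rewrite emulA areflectionK // emul1e.
have -> : T x = T s * T (emul s x) by rewrite -TM ?ex ?ls.
rewrite mulrA T_wall_sqr // mulrDl mul1r addrAC subrr add0r -mulrA.
exact/dvMr/dvVVi.
Qed.

Lemma T_len0M x y : G x -> G y -> len x = 0%N -> T (emul x y) = T x * T y.
Proof.
move=> hx hy l0; apply: TM => //; apply: lenM_add => // [||i].
- exact: (inWt_raut HD HOm hx).
- exact: (inWt_raut HD HOm hy).
have /eqP/(len0P HD HB Hp0 (inWt_raut HD HOm hx)) -> := l0.
by rewrite mul0r.
Qed.

(** Modulo [v - 1] the wall reflections of the left factor can be absorbed one at a time, by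
    induction on its length. *)
Lemma T_mul x y : G x -> G y -> dv (T x * T y - T (emul x y)).
Proof.
move=> hx hy; move: x hx; apply: length_ind => [x hx l0|i k x hx hw e IH].
  by rewrite T_len0M // subrr; apply: dv0.
set s := areflection i k in e *; have hs : G s by apply: inWt_areflection.
rewrite TM ?len_wall // -mulrA -emulA.
apply: (@dv_trans _ (T s * T (emul x y))); last by apply: T_wallM => //; apply: inWtM.
by rewrite -mulrBr; apply: dvMl.
Qed.

Lemma T_unit x : G x -> exists B, T x * B = 1 /\ B * T x = 1.
Proof.
move: x; apply: length_ind => [x hx l0|i k x hx hw e [B [h1 h2]]].
  have hV := inWtV HD HOm hx.
  have e : T x * T (einv x) = 1.
    by rewrite -T_len0M // (emulxV HD HOm) // T1.
  exists (T (einv x)); split=> //; rewrite -T_len0M ?(emulVx HD HOm) ?T1 //.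
  apply/eqP/(len0P HD HB Hp0 (inWt_raut HD HOm hV)) => i.
  have := congr1 (fun z => dep p0 z i) (emulVx HD HOm hx).
  rewrite /= depM //; [|exact: (inWt_raut HD HOm hV)|exact: (inWt_raut HD HOm hx)].
  have /eqP/(len0P HD HB Hp0 (inWt_raut HD HOm hx)) -> := l0.
  by rewrite addr0 => ->; rewrite /dep /= rpair0l ract1 // add0r subrr.
have [B' [h1' h2']] := T_wall_unit hw; have hs : G (areflection i k) by apply: inWt_areflection.
exists (B * B'); rewrite TM ?len_wall //; split.
  by rewrite -mulrA (mulrA (T x)) h1 mul1r.
by rewrite -mulrA (mulrA B') h2' mul1r.
Qed.

End Hecke.

(** * The commutator cocycle *)

Section Cocenter.
Variables (n : nat) (D : rdatum n) (Om : seq 'M[int]_n) (p0 : 'cV[rat]_n).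
Variables (C : numFieldType) (H : algType C) (T : elt n -> H) (V Vi : H).
Hypotheses (HD : is_root_datum D) (HB : is_base D) (HOm : is_diag_group D Om).
Hypotheses (Hp0 : in_alcove D p0) (HH : is_hecke D Om T V Vi).
Local Notation G := (inWt D Om).
Local Notation K := (@in_commutator C H).
Local Notation dv := (dv V).
Implicit Types (x y z g : elt n).

Let TMul x y (hx : G x) (hy : G y) : dv (T x * T y - T (emul x y)) :=
  T_mul HD HB HOm Hp0 HH hx hy.

(** The space [(v - 1)[H, H]], a priori smaller than the intersection of [[H, H]] with
    [(v - 1)H]. *)
Definition vK h := exists2 k, K k & h = (V - 1) * k.

Lemma vK0 : vK 0. Proof. by exists 0; rewrite ?mulr0 //; apply: commutator0. Qed.
Lemma vKD h h' : vK h -> vK h' -> vK (h + h').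
Proof.
move=> [c hc ->] [c' hc' ->]; exists (c + c'); rewrite ?mulrDr //.
exact: commutatorD.
Qed.
Lemma vKZ k h : vK h -> vK (k *: h).
Proof.
by move=> [c hc ->]; exists (k *: c); rewrite ?scalerAr //; apply: commutatorZ.
Qed.
Lemma vKN h : vK h -> vK (- h).
Proof. by move=> hh; rewrite -scaleN1r; apply: vKZ. Qed.
Lemma vKB h h' : vK h -> vK h' -> vK (h - h').
Proof. by move=> ? ?; apply/vKD => //; apply: vKN. Qed.
Lemma vKZ_inv k h : k != 0 -> vK (k *: h) -> vK h.
Proof. by move=> k0 /(vKZ k^-1); rewrite scalerA mulVf // scale1r. Qed.

Lemma commVl (h h' : H) : comm ((V - 1) * h) h' = (V - 1) * comm h h'.
Proof. by rewrite /comm mulrBr !mulrA (V1central HH h'). Qed.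
Lemma commVr (h h' : H) : comm h ((V - 1) * h') = (V - 1) * comm h h'.
Proof. by rewrite /comm mulrBr !mulrA (V1central HH h). Qed.

Lemma comm_dv A A' B B' : dv (A - A') -> dv (B - B') -> vK (comm A B - comm A' B').
Proof.
move=> [c hc] [d hd]; exists (comm c B + comm A' d).
  by apply: commutatorD; apply: commutator_comm.
have -> : A = A' + (V - 1) * c by rewrite -hc addrC subrK.
rewrite commDl commVl {1}(_ : B = B' + (V - 1) * d); last by rewrite -hd addrC subrK.
by apply/eqP; rewrite commDr commVr subr_eq (mulrDr _ (comm c B)) -addrA addrC
  [_ + _ * comm c _]addrC.
Qed.

(** With [x = g y^-1] this is [[T_x, T_y]], where [xy = g] and [yx = y g y^-1]: it belongs to the
    arrow [y] from [g] to [y g y^-1]. *)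
Definition cocycle g y := comm (T (emul g (einv y))) (T y).

Lemma einvM x y : G x -> G y -> einv (emul x y) = emul (einv y) (einv x).
Proof.
move=> hx hy; have hxy := inWtM HD HOm hx hy.
have hx' := inWtV HD HOm hx; have hy' := inWtV HD HOm hy.
rewrite -[RHS](emulK HD HOm _ hxy) -(emulA (einv y)) (emulA (einv x)).
by rewrite (emulVx HD HOm hx) emul1e (emulVx HD HOm hy) emul1e.
Qed.

(* The Hochschild identity [xy, z] - [x, yz] + [zx, y] = 0. *)
Lemma cocycleM g y z : G g -> G y -> G z ->
  vK (cocycle g (emul y z) -
      (cocycle g z + cocycle (emul (emul z g) (einv z)) y)).
Proof.
move=> hg hy hz; have hy' := inWtV HD HOm hy; have hz' := inWtV HD HOm hz.
(* With this [x] the three commutators are [[x, yz]], [[xy, z]] and [[zx, y]]. *)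
pose x := emul (emul g (einv z)) (einv y).
have hx : G x by do !apply: inWtM.
have e1 : emul g (einv (emul y z)) = x by rewrite einvM // emulA.
have e2 : emul g (einv z) = emul x y by rewrite /x (emulKV HD HOm).
have e3 : emul (emul (emul z g) (einv z)) (einv y) = emul z x by rewrite /x !emulA.
rewrite /cocycle e1 e2 e3.
have -> : comm (T x) (T (emul y z)) - (comm (T (emul x y)) (T z) + comm (T (emul z x)) (T y))
  = (comm (T x * T y) (T z) - comm (T (emul x y)) (T z))
    + (comm (T z * T x) (T y) - comm (T (emul z x)) (T y))
    - (comm (T x) (T y * T z) - comm (T x) (T (emul y z))).
  have zid (P Q R U W : H) : P - (Q + R) = (W - U - Q) + (U - R) - (W - P).
    by rewrite opprB (addrACA (W - U)) subrK -opprD [RHS]addrC addrA subrK.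
  by rewrite (commMl (T x)); exact: zid.
have sub0 (h : H) : dv (h - h) by rewrite subrr; apply: dv0.
by apply: vKB; first apply: vKD; apply: comm_dv => //; apply: TMul.
Qed.

Lemma cocycle_root_trivial g b : G g -> G b -> emul g b = emul b g ->
  (forall i : 'I_(nroots D), ract b.2 i = i) -> vK (cocycle g b).
Proof.
move=> hg hb gb b1.
have [N [l1 l2]] := len_stable HD HB Hp0 (inWt_raut HD HOm hg) (inWt_raut HD HOm hb) gb b1.
set y := emul g (epow b N) in l1 l2.
have hy : G y by apply: inWtM => //; apply: inWt_epow.
have eyb : emul b y = emul y b by rewrite /y emulA -gb -!emulA -epowS epowSr.
have cYB : T y * T b = T b * T y.
  by rewrite -(TM HD HB HOm Hp0 HH hy hb l1) -(TM HD HB HOm Hp0 HH hb hy l2) eyb.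
have [B [bB Bb]] := T_unit HD HB HOm Hp0 HH hb.
(* This element commutes with [T b] exactly, and it lifts [g b^-1] modulo [v - 1] since
   [g b^-1 b^(N+1) = y]. *)
have hA : comm (T y * B ^+ N.+1) (T b) = 0.
  apply/commC0/esym; apply: commrM; first exact/esym.
  by apply: commrX; rewrite /GRing.comm bB Bb.
have hb' := inWtV HD HOm hb; have hgb := inWtM HD HOm hg hb'.
have hpow k x : G x -> dv (T x * T b ^+ k - T (emul x (epow b k))).
  move=> hx; elim: k => [|k IH]; first by rewrite mulr1 emule1 subrr; apply: dv0.
  rewrite exprSr mulrA epowSr emulA.
  apply: (dv_trans (h2 := T (emul x (epow b k)) * T b)); last first.
    by apply: TMul => //; apply: inWtM => //; apply: inWt_epow.
  by rewrite -mulrBl; apply: dvMr.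
have e : emul (emul g (einv b)) (epow b N.+1) = y.
  by rewrite epowS emulA (emulKV HD HOm).
have hcan k : T b ^+ k * B ^+ k = 1.
  elim: k => [|k IH]; first by rewrite mulr1.
  by rewrite exprSr exprS mulrA -(mulrA _ (T b)) bB mulr1.
have dA : dv (T (emul g (einv b)) - T y * B ^+ N.+1).
  rewrite -[T (emul g (einv b))]mulr1 -(hcan N.+1) mulrA -mulrBl -e.
  exact/dvMr/hpow.
have sub0 (h : H) : dv (h - h) by rewrite subrr; apply: dv0.
by have := comm_dv dA (sub0 (T b)); rewrite hA subr0.
Qed.

(** On the centralizer the cocycle is additive modulo [vK], so its value at [z^(N+1)], which is zero
    for a root-trivial power, is [N + 1] times its value at [z]; characteristic zero allows
    division. *)
Lemma cocycle_central g z : G g -> G z -> emul g z = emul z g -> vK (cocycle g z).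
Proof.
move=> hg hz gz.
have [N hN] := exists_root_trivial_pow HD (inWt_raut HD HOm hz).
have comz k : emul g (epow z k) = emul (epow z k) g.
  elim: k => [|k IH]; first by rewrite emul1e emule1.
  by rewrite epowS -emulA -IH !emulA gz.
have hpow k : vK (cocycle g (epow z k.+1) - k.+1%:R *: cocycle g z).
  elim: k => [|k IH]; first by rewrite scale1r epow1 subrr; apply: vK0.
  have hk : G (epow z k.+1) by apply: inWt_epow.
  have := cocycleM hg hz hk; rewrite -epowS -comz (emulK HD HOm) // => /vKD/(_ IH).
  congr vK; rewrite -[k.+2%:R]natr1 scalerDl scale1r.
  have zid (P Q R S : H) : P - (Q + R) + (Q - S) = P - (S + R).
    by rewrite opprD (addrA P) (addrACA (P - Q)) subrK -opprD (addrC R).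
  exact: zid.
have := vKB (cocycle_root_trivial hg (inWt_epow HD HOm N.+1 hz) (comz _) hN) (hpow N).
by rewrite opprB addrC subrK; apply: vKZ_inv; rewrite pnatr_eq0.
Qed.

Definition conj_rep g : elt n -> Prop :=
  fun g0 => G g0 /\ exists2 h, G h & emul h g0 = emul g h.
Definition pick_elt (P : elt n -> Prop) : elt n :=
  if pselect (exists x, P x) is left e then projT1 (cid e) else eone n.
Lemma pick_eltP (P : elt n -> Prop) : (exists x, P x) -> P (pick_elt P).
Proof. by rewrite /pick_elt; case: pselect => // e _; case: cid. Qed.

(* A representative of the conjugacy class of [g]: it depends on the class only,
   since [pick_elt] is applied to a predicate depending on the class only. *)
Definition crep g : elt n := pick_elt (conj_rep g).
Definition cconj g : elt n := pick_elt (fun h => G h /\ emul h (crep g) = emul g h).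

Lemma crepP g : G g -> G (crep g).
Proof.
move=> hg; have : conj_rep g (crep g); last by case.
apply: pick_eltP; exists g; split=> //; exists (eone n); first exact: inWt1.
by rewrite emul1e emule1.
Qed.
Lemma cconjP g : G g -> G (cconj g) /\ emul (cconj g) (crep g) = emul g (cconj g).
Proof.
move=> hg; apply: (@pick_eltP (fun h => G h /\ emul h (crep g) = emul g h)).
have : conj_rep g (crep g).
  apply: pick_eltP; exists g; split=> //; exists (eone n); first exact: inWt1.
  by rewrite emul1e emule1.
by move=> [_ [h ? ?]]; exists h.
Qed.

(** Since [xy] and [yx] are conjugate, the two predicates are equal by extensionality, and the
    choice returns the same element. *)
Lemma crepC x y : G x -> G y -> crep (emul x y) = crep (emul y x).
Proof.
move=> hx hy; congr pick_elt; apply/funext => g0; apply/propext; split.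
  move=> [h0 [h hh e]]; split=> //; exists (emul y h); first exact: inWtM.
  by rewrite -emulA e !emulA.
move=> [h0 [h hh e]]; split=> //; exists (emul x h); first exact: inWtM.
by rewrite -emulA e !emulA.
Qed.

(** The cocycle along the chosen arrow from the class representative to [g]. *)
Definition potential g : H := cocycle (crep g) (cconj g).

(** Two arrows lead from the representative [g0] to [yx]: [y h], passing through [xy], and the
    chosen [h']. They differ by some [z] in the centralizer of [g0], where the cocycle vanishes. *)
Lemma comm_potential x y : G x -> G y ->
  vK (comm (T x) (T y) - (potential (emul y x) - potential (emul x y))).
Proof.
move=> hx hy; set g := emul x y; set g' := emul y x.
have hg : G g by apply: inWtM.
have hg' : G g' by apply: inWtM.
have [hh eh] := cconjP hg; have [hh' eh'] := cconjP hg'.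
have hr := crepP hg.
rewrite /potential; have er : crep g' = crep g by apply: crepC.
rewrite er in eh' *.
set g0 := crep g in eh eh' hr *.
set h := cconj g in hh eh *; set h' := cconj g' in hh' eh' *.
have hh'' := inWtV HD HOm hh'.
have [z hz ehz] : exists2 z, G z & emul h' z = emul y h.
  exists (emul (einv h') (emul y h)); first by do !apply: inWtM.
  by rewrite emulA (emulxV HD HOm) // emul1e.
have gz : emul g0 z = emul z g0.
  have : emul h' (emul g0 z) = emul h' (emul z g0).
    rewrite (emulA h' g0) eh' -(emulA g' h') ehz (emulA h' z) ehz -(emulA y h) eh.
    by rewrite /g /g' !emulA.
  by move/(congr1 (emul (einv h'))); rewrite 2!(emulA (einv h')) (emulVx HD HOm) // !emul1e.
have c1 := cocycleM hr hy hh; have c2 := cocycleM hr hh' hz.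
rewrite eh (emulK HD HOm) // in c1.
rewrite -gz (emulK HD HOm) // ehz in c2.
have c3 := cocycle_central hr hz gz.
have ec : cocycle g y = comm (T x) (T y) by rewrite /cocycle /g (emulK HD HOm).
have := vKD (vKB c2 c1) c3; congr vK; rewrite -ec.
have zid (P P' Q R S : H) : P' - (S + P) - (P' - (Q + R)) + S = R - (P - Q).
  rewrite [- (P' - _)]opprB [X in X + S]addrC addrA subrK opprD addrA.
  by rewrite addrAC subrK opprB addrA (addrC R).
exact: zid.
Qed.

End Cocenter.

(** * Specialization at v = 1 *)

Section Specialization.
Variables (n : nat) (D : rdatum n) (Om : seq 'M[int]_n) (p0 : 'cV[rat]_n).
Variables (C : numFieldType) (H : algType C) (T : elt n -> H) (V Vi : H).
Hypotheses (HD : is_root_datum D) (HB : is_base D) (HOm : is_diag_group D Om).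
Hypotheses (Hp0 : in_alcove D p0) (HH : is_hecke D Om T V Vi).
Local Notation G := (inWt D Om).
Local Notation K := (@in_commutator C H).
Local Notation dv := (dv V).
Local Notation vK := (vK V).

Definition hbasis (e : int * elt n) : H := lpow V Vi e.1 * T e.2.
Local Notation term := (C * (int * elt n))%type.

Lemma sum_collect (U : lmodType C) (F : int * elt n -> U) (l : seq term) :
  \sum_(t <- l) t.1 *: F t.2 =
  \sum_(e <- undup [seq t.2 | t <- l]) (\sum_(t <- l | t.2 == e) t.1) *: F e.
Proof.
under [RHS]eq_bigr do rewrite scaler_suml.
under [RHS]eq_bigr do rewrite big_mkcond.
rewrite exchange_big /= big_seq [RHS]big_seq; apply: eq_bigr => t ht.

rewrite (bigD1_seq t.2) ?undup_uniq ?mem_undup ?map_f //=.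
rewrite eqxx big1_seq ?addr0 // => e /andP[he _]; case: eqP => // e'.
by rewrite e' eqxx in he.
Qed.

(** Once repeated indices are gathered, all coefficients vanish; so the relation persists when basis
    elements are replaced by arbitrary vectors. *)
Lemma hbasis_free (l : seq term) : (forall t, t \in l -> G t.2.2) ->
  \sum_(t <- l) t.1 *: hbasis t.2 = 0 ->
  forall (U : lmodType C) (F : int * elt n -> U), \sum_(t <- l) t.1 *: F t.2 = 0.
Proof.
move=> hl h0 U F; rewrite sum_collect big_seq big1 // => e he.
case: HH => _ [_ [_ [hf _]]].
rewrite (hf _ (undup_uniq _) _ (fun e => \sum_(t <- l | t.2 == e) t.1) _ e he) ?scale0r //.
  by move=> e'; rewrite mem_undup => /mapP[t /hl ht ->].
by rewrite -[RHS]h0 sum_collect.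
Qed.

Lemma expansion_exists (h : H) : exists l : seq term,
  (forall t, t \in l -> G t.2.2) /\ h = \sum_(t <- l) t.1 *: hbasis t.2.
Proof.
case: HH => _ [_ [_ [_ [hs _]]]]; have [s [c [hG ->]]] := hs h.
exists [seq (c e, e) | e <- s]; rewrite big_map; split=> // t /mapP[e /hG he ->].
exact: he.
Qed.

Definition expansion h : seq term := projT1 (cid (expansion_exists h)).
Lemma expansionG h t : t \in expansion h -> G t.2.2.
Proof. by rewrite /expansion; case: cid => l [h1 _] /=; apply: h1. Qed.
Lemma expansionE h : h = \sum_(t <- expansion h) t.1 *: hbasis t.2.
Proof. by rewrite /expansion; case: cid => l [_ h2] /=. Qed.

(** * Linear extension from the basis *)

Section Extend.
Variables (U : lmodType C) (F : int * elt n -> U).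

Definition hext h : U := \sum_(t <- expansion h) t.1 *: F t.2.

(** Two expansions of an element differ by a relation, which [hbasis_free] carries over to [F]; so
    the value does not depend on the chosen expansion. *)
Lemma hextE (l : seq term) : (forall t, t \in l -> G t.2.2) ->
  hext (\sum_(t <- l) t.1 *: hbasis t.2) = \sum_(t <- l) t.1 *: F t.2.
Proof.
move=> hl; set h := \sum_(t <- l) _; apply/eqP; rewrite -subr_eq0; apply/eqP.
pose l' := expansion h ++ [seq (- t.1, t.2) | t <- l].
have e (U' : lmodType C) (F' : int * elt n -> U') :
    \sum_(t <- l') t.1 *: F' t.2 =
    \sum_(t <- expansion h) t.1 *: F' t.2 - \sum_(t <- l) t.1 *: F' t.2.
  rewrite big_cat big_map -sumrN; congr (_ + _); apply: eq_bigr => t _ /=.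
  by rewrite scaleNr.
rewrite /hext -e; apply: hbasis_free; last by rewrite e -expansionE subrr.
move=> t; rewrite mem_cat => /orP[/expansionG //|/mapP[t' /hl ht ->]].
exact: ht.
Qed.

Lemma hext_basis k g : G g -> hext (hbasis (k, g)) = F (k, g).
Proof.
move=> hg; have := @hextE [:: (1, (k, g))]; rewrite !big_seq1 !scale1r; apply.
by move=> t; rewrite mem_seq1 => /eqP ->.
Qed.

Lemma hextD h h' : hext (h + h') = hext h + hext h'.
Proof.
rewrite {1}(expansionE h) {1}(expansionE h') -big_cat hextE ?big_cat // => t.
by rewrite mem_cat => /orP[] /expansionG.
Qed.

Lemma hextZ k h : hext (k *: h) = k *: hext h.
Proof.
rewrite {1}(expansionE h) scaler_sumr.
have := @hextE [seq (k * t.1, t.2) | t <- expansion h]; rewrite !big_map /=.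
under eq_bigr do rewrite -scalerA.
under [in RHS]eq_bigr do rewrite -scalerA.
move=> ->; first by rewrite /hext scaler_sumr.
by move=> t /mapP[t' /expansionG ht ->].
Qed.

Lemma hext0 : hext 0 = 0.
Proof. by have := hextZ 0 0; rewrite !scale0r. Qed.
Lemma hextB h h' : hext (h - h') = hext h - hext h'.
Proof. by rewrite hextD -[- h']scaleN1r hextZ scaleN1r. Qed.
Lemma hext_sum I (r : seq I) (f : I -> H) :
  hext (\sum_(i <- r) f i) = \sum_(i <- r) hext (f i).
Proof. exact: (big_morph hext hextD hext0). Qed.

End Extend.

Lemma V_lpow k : V * lpow V Vi k = lpow V Vi (1 + k).
Proof.
case: k => [k|[|k]].
- by rewrite (_ : 1 + Posz k = Posz k.+1) /= ?exprS //; lia.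
- by rewrite (_ : 1 + Negz 0 = 0) /= ?expr1 ?(VVi HH) //; lia.
by rewrite (_ : 1 + Negz k.+1 = Negz k) /= ?[Vi ^+ k.+2]exprS ?mulrA ?(VVi HH) ?mul1r //; lia.
Qed.

Lemma hext_V (U : lmodType C) (F : int * elt n -> U) h :
  hext F (V * h) = hext (fun e => F (1 + e.1, e.2)) h.
Proof.
rewrite {1}(expansionE h) mulr_sumr [RHS]/hext.
have := hextE F (l := [seq (t.1, (1 + t.2.1, t.2.2)) | t <- expansion h]).
rewrite !big_map /= => <-; last by move=> t /mapP[t' /expansionG ht ->].
by congr hext; apply: eq_bigr => t _; rewrite -scalerAr /hbasis mulrA V_lpow.
Qed.

(** If [V h = h], the coefficients of [h] are unchanged by shifting the exponent of [v], yet only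
    finitely many are nonzero. *)
Lemma V1_reg h : (V - 1) * h = 0 -> h = 0.
Proof.
move=> h0; have Vh : V * h = h.
  by apply/eqP; rewrite -subr_eq0 -{2}[h]mul1r -mulrBl h0.
pose coef e0 h : C^o := hext (fun e => (e == e0)%:R : C^o) h.
have cV k g : coef (k, g) h = coef (1 + k, g) h.
  rewrite -{2}Vh /coef hext_V; congr (hext _ h); apply/funext => e /=.
  by rewrite !xpair_eqE (inj_eq (addrI _)) -xpair_eqE; case: e.
have cN k g N : coef (k, g) h = coef (k + N%:Z, g) h.
  elim: N => [|N ->]; first by rewrite addr0.
  by rewrite cV; congr (coef (_, _) h); lia.
have c0 k g : coef (k, g) h = 0.
  (* A bound for the exponents in the expansion; [k + |k| + B + 1] exceeds it. *)
  pose B := (\sum_(t <- expansion h) `|t.2.1|)%N.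
  rewrite (cN _ _ (`|k| + B.+1)%N) /coef /hext big_seq big1 // => t ht.
  case: eqP => [e|]; last by rewrite scaler0.
  have : (`|t.2.1| <= B)%N by rewrite /B (big_rem t) //= leq_addr.
  by rewrite e /=; lia.
rewrite (expansionE h) sum_collect big1 // => e _.
suff -> : \sum_(t <- expansion h | t.2 == e) t.1 = coef e h by case: e => k g; rewrite c0 scale0r.
rewrite /coef /hext big_mkcond; apply: eq_bigr => t _.
by case: eqP => _; rewrite ?scaler0 // /GRing.scale /= mulr1.
Qed.

Lemma comm_basis_ind (Q : H -> Prop) : Q 0 -> (forall h h', Q h -> Q h' -> Q (h + h')) ->
  (forall k h, Q h -> Q (k *: h)) ->
  (forall k l x y, G x -> G y -> Q (comm (hbasis (k, x)) (hbasis (l, y)))) ->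
  forall h, K h -> Q h.
Proof.
move=> Q0 QD QZ QC.
have Qs (I : eqType) (r : seq I) (F : I -> H) :
    (forall i, i \in r -> Q (F i)) -> Q (\sum_(i <- r) F i).
  by move=> hr; rewrite big_seq; apply: big_ind.
move=> h [s ->]; apply: (Qs) => -[x y] _ /=; rewrite -/(comm x y).
rewrite (expansionE x) comm_suml; apply: (Qs) => -[c [k g]] /expansionG hg /=.
rewrite (expansionE y) comm_sumr; apply: (Qs) => -[d [l g']] /expansionG hg' /=.
by rewrite commZl commZr; exact/QZ/QZ/QC.
Qed.

Lemma lpow_dv k : dv (lpow V Vi k - 1).
Proof.
have hp (v : H) j : dv (v - 1) -> dv (v ^+ j - 1).
  move=> hv; elim: j => [|j IH]; first by rewrite subrr; apply: dv0.
  by rewrite exprS -[1]mulr1; apply: (dv_mul HH).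
case: k => j /=; apply: hp; first by exists 1; rewrite mulr1.
by exists (- Vi); rewrite mulrN mulrBl mul1r (VVi HH) opprB.
Qed.

Lemma hbasis_dv k g : dv (hbasis (k, g) - T g).
Proof.
rewrite /hbasis /= -{2}[T g]mul1r; apply: (dv_mul HH); first exact: lpow_dv.
by rewrite subrr; apply: dv0.
Qed.

(** * Linear maps factoring through v = 1 *)

Section AtOne.
Variables (U : lmodType C) (f : elt n -> U).

(** The linear extension of [f] to the group algebra, after setting [v = 1]: the exponent of [v] is
    ignored. *)
Definition spec h := hext (fun e => f e.2) h.

Lemma spec_dv h : dv h -> spec h = 0.
Proof. by move=> [c ->]; rewrite mulrBl mul1r /spec hextB hext_V subrr. Qed.

Lemma spec_eq h h' : dv (h - h') -> spec h = spec h'.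
Proof. by move/spec_dv; rewrite /spec hextB => /eqP; rewrite subr_eq0 => /eqP. Qed.

Lemma spec_T g : G g -> spec (T g) = f g.
Proof.
move=> hg; rewrite -(spec_eq (hbasis_dv 0 g)) /spec hext_basis //.
Qed.

Lemma spec_comm k l x y : G x -> G y ->
  spec (comm (hbasis (k, x)) (hbasis (l, y))) = f (emul x y) - f (emul y x).
Proof.
move=> hx hy; rewrite /comm /spec hextB -!/(spec _).
have e k' l' x' y' : G x' -> G y' ->
    spec (hbasis (k', x') * hbasis (l', y')) = f (emul x' y').
  move=> hx' hy'; rewrite -spec_T; last exact: inWtM.
  apply: spec_eq; apply: dv_trans (T_mul HD HB HOm Hp0 HH hx' hy').
  by apply: (dv_mul HH); apply: hbasis_dv.
by rewrite !e.
Qed.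

End AtOne.

(** With [p] the potential, [tau] maps [[T_y, T_z]] to [p(yz) - p(zy)], so [x + tau x] lies in [(v -
    1)[H, H]] for all [x] in [[H, H]]. At [x = (v - 1) h] the term [tau x] is zero, and [v - 1]
    cancels. *)
Lemma cocenter_torsion_free h : K ((V - 1) * h) -> K h.
Proof.
pose tau := spec (potential D Om T).
have Q x : K x -> vK (x + tau x).
  move: x; apply: (comm_basis_ind (Q := fun x => vK (x + tau x)))
    => [|y z hy hz|k y hy|k l y z hy hz].
  - by rewrite /tau /spec hext0 addr0; apply: vK0.
  - by rewrite /tau /spec hextD addrACA; apply: vKD.
  - by rewrite /tau /spec hextZ -scalerDr; apply: vKZ.
  rewrite /tau spec_comm //.
  have h1 := comm_dv HH (hbasis_dv k y) (hbasis_dv l z).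
  have h2 := comm_potential HD HB HOm Hp0 HH hy hz.
  by have := vKD h1 h2; rewrite addrA subrK opprB.
move/Q; rewrite /tau spec_dv; last by exists h.
rewrite addr0 => -[k hk e]; suff -> : h = k by [].
by apply/eqP; rewrite -subr_eq0; apply/eqP/V1_reg; rewrite mulrBr e subrr.
Qed.

End Specialization.

(** * Linear independence *)

Section Independence.
Variables (n : nat) (D : rdatum n) (Om : seq 'M[int]_n) (p0 : 'cV[rat]_n).
Variables (C : numFieldType) (H : algType C) (T : elt n -> H) (V Vi : H).
Hypotheses (HD : is_root_datum D) (HB : is_base D) (HOm : is_diag_group D Om).
Hypotheses (Hp0 : in_alcove D p0) (HH : is_hecke D Om T V Vi).
Local Notation G := (inWt D Om).
Local Notation K := (@in_commutator C H).

Lemma crep_conjugate x y : G x -> G y -> crep D Om x = crep D Om y -> conjugate D Om x y.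
Proof.
move=> hx hy e; have [hc ec] := cconjP HOm hx; have [hd ed] := cconjP HOm hy.
exists (emul (cconj D Om y) (einv (cconj D Om x))); split.
  by apply: inWtM => //; apply: inWtV.
have er : emul (einv (cconj D Om x)) x = emul (crep D Om x) (einv (cconj D Om x)).
  rewrite -[RHS]emul1e -(emulVx HD HOm hc) -emulA (emulA _ (crep _ _ _)) ec.
  by rewrite (emulK HD HOm).
by rewrite -emulA er e emulA ed emulA.
Qed.

(** The indicator function of the conjugacy class of [g]. *)
Definition class_fun g : elt n -> C^o := fun x => (crep D Om x == crep D Om g)%:R.

Lemma spec_class_commutator g h : K h -> spec HH (class_fun g) h = 0.
Proof.
move: h; apply: (comm_basis_ind HH (Q := fun h => spec HH (class_fun g) h = 0)).
- by rewrite /spec hext0.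
- by move=> h h' e e'; rewrite /spec hextD -!/(spec _ _ _) e e' addr0.
- by move=> k h e; rewrite /spec hextZ -/(spec _ _ _) e scaler0.
move=> k l x y hx hy; rewrite (spec_comm HD HB HOm Hp0) // /class_fun.
by rewrite (crepC HD HOm hx hy) subrr.
Qed.

Lemma horner_V_dv (P : {poly C}) : dv V (horner_alg V P - P.[1]%:A).
Proof.
elim/poly_ind: P => [|P c IH]; first by rewrite rmorph0 horner0 scale0r subrr; apply: dv0.
rewrite rmorphD rmorphM /= horner_algX horner_algC !hornerE scalerDl opprD addrACA subrr addr0.
rewrite -[P.[1]%:A]mulr1; apply: (dv_mul HH) => //.
by exists 1; rewrite mulr1.
Qed.

(** Induction on the total size of the polynomials: all of them vanish at 1, and dividing them by
    [X - 1] keeps the combination in [[H, H]] by torsion-freeness. *)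
Lemma horner_V_independent r (w : 'I_r -> elt n) (P : 'I_r -> {poly C}) :
  (forall i, G (w i)) -> (forall i j, i != j -> ~ conjugate D Om (w i) (w j)) ->
  K (\sum_i horner_alg V (P i) * T (w i)) -> forall i, P i = 0.
Proof.
move=> hw hconj.
have [N hN] : exists N, (\sum_i size (P i) <= N)%N by exists (\sum_i size (P i))%N.
elim: N P hN => [|N IH] P hN hK i.
  apply/eqP; rewrite -size_poly_eq0 -leqn0; apply: leq_trans hN.
  by rewrite (bigD1 i) //= leq_addr.
(* At [v = 1] the class function of [w j] sees the [j]-th term only. *)
have P1 j : (P j).[1] = 0.
  have := spec_class_commutator (w j) hK; rewrite /spec hext_sum.
  rewrite (bigD1 j) //= big1 => [|k kj].
    rewrite addr0 -/(spec _ _ _) => <-.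
    rewrite (spec_eq HH _ (h' := (P j).[1] *: T (w j))); last first.
      rewrite -[_ *: T _]mulr_algl; apply: (dv_mul HH); first exact: horner_V_dv.
      by rewrite subrr; apply: dv0.
    by rewrite /spec hextZ -/(spec _ _ _) spec_T // /class_fun eqxx /GRing.scale /= mulr1.
  rewrite -/(spec _ _ _) (spec_eq HH _ (h' := (P k).[1] *: T (w k))); last first.
    rewrite -[_ *: T _]mulr_algl; apply: (dv_mul HH); first exact: horner_V_dv.
    by rewrite subrr; apply: dv0.
  rewrite /spec hextZ -/(spec _ _ _) spec_T // /class_fun.
  case: eqP => [e|_]; last by rewrite scaler0.
  by case: (hconj _ _ kj); apply: crep_conjugate.
pose Q j := P j %/ ('X - 1%:P).
have PQ j : P j = Q j * ('X - 1%:P).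
  by rewrite divpK // dvdp_XsubCl; apply/rootP/P1.
have hQK : K (\sum_j horner_alg V (Q j) * T (w j)).
  apply: (cocenter_torsion_free HD HB HOm Hp0 HH); move: hK; congr K.
  rewrite mulr_sumr; apply: eq_bigr => j _; rewrite {1}PQ rmorphM rmorphB /=.
  by rewrite horner_algX rmorph1 mulrA (V1central HH).
(* Unless all [P j] are zero, some size drops strictly. *)
have [/forallP h0|/forallPn [k hk]] := boolP [forall j, P j == 0]; first exact/eqP.
have sQ j : P j != 0 -> size (P j) = (size (Q j)).+1.
  move=> pj; rewrite PQ size_Mmonic ?monicXsubC ?size_XsubC ?addn2 //.
  by apply: contra_neq pj => e; rewrite PQ e mul0r.
rewrite PQ (IH Q) ?mul0r //; rewrite -ltnS; apply: leq_trans hN.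
rewrite (bigD1 k) //= [X in (_ < X)%N](bigD1 k) //= (sQ k hk) addSn ltnS leq_add2l.
apply: leq_sum => j _; have [e|/sQ ->] := eqVneq (P j) 0; last exact: leqnSn.
by rewrite /Q e div0p size_poly0.
Qed.

(** A large power of [v] clears the negative exponents. Every [N' >= N] is allowed, so that several
    coefficients can share one exponent. *)
Lemma laurent_shift c : in_laurent V Vi c ->
  exists N, forall N', (N <= N')%N -> exists P : {poly C}, V ^+ N' * c = horner_alg V P.
Proof.
move=> [s [d ->]]; exists (\sum_(k <- s) `|k|)%N => N' hN'.
exists (\sum_(k <- s) d k *: 'X^(`|N'%:Z + k|)).
rewrite mulr_sumr rmorph_sum /= big_seq [RHS]big_seq; apply: eq_bigr => k hk.
rewrite linearZ /= rmorphXn /= horner_algX mulr_algl -scalerAr; congr (_ *: _).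
have : (`|k| <= N')%N by apply: leq_trans hN'; rewrite (big_rem k) //= leq_addr.
case: k {hk} => k h /=; first by rewrite -exprD.
have e : N' = (`|(N'%:Z + Negz k)%R| + k.+1)%N by lia.
rewrite {1}e exprD -mulrA -exprMn_comm ?(VVi HH) ?expr1n ?mulr1 //.
by rewrite /GRing.comm (VVi HH) (ViV HH).
Qed.

End Independence.

Theorem theorem6p8 (n : nat) (D : rdatum n) (Om : seq 'M[int]_n)
  (C : numClosedFieldType) (H : algType C) (T : elt n -> H) (V Vi : H)
  (r : nat) (w : 'I_r -> elt n) :
  is_root_datum D -> is_base D -> is_diag_group D Om ->
  is_hecke D Om T V Vi ->
  (forall i, inWt D Om (w i)) ->
  (forall i j, i != j -> ~ conjugate D Om (w i) (w j)) ->
  forall c : 'I_r -> H, (forall i, in_laurent V Vi (c i)) ->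
  in_commutator (\sum_i c i * T (w i)) -> forall i, c i = 0.
Proof.
move=> HD HB HOm HH hw hconj c hc hK.
have [p0 Hp0] := exists_alcove_point HD HB.
have [N hN] := choice (fun i => laurent_shift HH (hc i)).
(* At least each [N i], so that one power of [v], which is invertible, clears all coefficients. *)
pose M := (\sum_i N i)%N.
have [P hP] := choice (fun i => hN i M (leq_trans (leq_addr _ _) (eq_leq (esym (bigD1 i isT))))).
have P0 : forall i, P i = 0.
  apply: (horner_V_independent HD HB HOm Hp0 HH hw hconj).
  have := commutatorM (v := V ^+ M) _ hK; rewrite mulr_sumr => h.
  under eq_bigr do rewrite -hP -mulrA.
  by apply: h => x; apply/esym/commrX; rewrite /GRing.comm (Vcentral HH).
move=> i; have : Vi ^+ M * (V ^+ M * c i) = 0 by rewrite hP P0 rmorph0 mulr0.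
rewrite mulrA -exprMn_comm ?(ViV HH) ?expr1n ?mul1r //.
by rewrite /GRing.comm (VVi HH) (ViV HH).
Qed.
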